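(* Let $c_0>0$ be an arbitrary real number. Then there exist constants $x_0>0$ and $c>0$, depending only on $c_0$, such that the following holds for all real $x\ge x_0$. For every set of primes $A\subseteq \mathcal{P}\cap[1,x]$ satisfying $|A|=\delta x(\log x)^{-1}$ with $\delta\ge(\log x)^{-c_0}$, one has $$|A+A|\ \ge\ c\,\delta x(\log\log x)^{-1}.$$
   Context: $\mathcal{P}$ denotes the set of all primes, $|S|$ denotes the cardinality of a finite set $S$, $A+A=\{a+a' : a,a'\in A\}$, and $\log$ is the natural logarithm. *)

(* Defs.v *)
From mathcomp Require Import all_boot all_order all_algebra.
From mathcomp Require Import finmap.

Set Implicit Arguments.
Unset Strict Implicit.
Unset Printing Implicit Defensive.

Local Open Scope fset_scope.

Definition sumset (A B : {fset nat}) : {fset nat} :=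
  [fset (a + b)%N | a in A, b in B].

(* Main.v *)
Require Import Defs.
From mathcomp Require Import all_boot all_order all_algebra.
From mathcomp Require Import finmap.
From mathcomp Require Import reals sequences exp.
From mathcomp Require Import ring lra zify.

Import Order.TTheory GRing.Theory Num.Theory.
Local Open Scope fset_scope.
Local Open Scope ring_scope.

(** Let [h n] be the Selberg weight at level [y], sieving by the primes in
    [(z, y]] with [z] a power of [log x] and [y] a small power of [x].  It takes
    the value [L >> log x / log log x] at primes [> y], so with [S = A + A],
    [|A| |A'| L^2 <= \sum_(s in S, a in A) h (s - a)^2], where [A'] is the part
    of [A] above [y].  The mean value of [h^2] is [L]; if [A] were
    equidistributed with respect to the oscillating part of [h^2], the right
    side would be close to [|S| |A| L], giving [|S| >> |A'| L].  No such
    information on [A] is needed: by Cauchy-Schwarz, [a] may range over all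
    integers up to [x] in the second moment of the oscillating part, which is
    then computed exactly by the Chinese remainder theorem.  As every modulus is
    a product of primes [> z], only pairs [s = s'] contribute significantly. *)

Set Implicit Arguments.
Unset Strict Implicit.
Unset Printing Implicit Defensive.


(** The loss of [log log x] comes from [z] alone. For [s != s'] the difference [s - s'] may still be
    divisible by some of the moduli, so such a pair is smaller than a diagonal one only by a factor
    of about [log x / z]. This has to beat the density [(log x)^(-c0)] and losses that are fixed
    powers of [log x] (the powers of [M]), so [z] is taken to be [log x] to a power [c0 + O(1)].
    Leaving out the primes up to [z] divides the lower bound for [L] by
    [\prod_(q <= z) q / (q - 1)], which is of order [log z], that is [log log x]. Hence only this
    lower bound must be right up to a constant; elsewhere powers of [log x] may be wasted, and
    coefficients are bounded by absolute values. The second moment is computable because [psi m]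
    takes two values: it has mean zero modulo [m], and its square is affine in it. So the squared
    weight is a combination of products of [psi] over sets [Q] of primes, with constant coordinate
    exactly [L], and products over different [Q] are orthogonal over a full period. Incomplete
    periods cost a power of [y], which is why [y] is a small power of [x]. *)

(** * Upper bounds of Chebyshev and Mertens type *)

Lemma prime_mul_ln_le (R : realType) (n : nat) : (0 < n)%N ->
  \sum_(p < n.+1 | prime p) ln (p%:R : R) / p%:R <= 2 * ln n%:R.
Proof.
move=> n0.
have nR : (0 : R) < n%:R by rewrite ltr0n.
(* By Legendre's formula the exponent of [p] in [n!] is at least [n %/ p], and [n!] is at most
   [n ^ n]. *)
have hdvd : (\prod_(p < n.+1 | prime p) p ^ (n %/ p) <= n ^ n)%N.
  apply: (@leq_trans n`!); last first.
    elim: (n) => // -[|m] IH //; rewrite factS expnS leq_mul2l.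
    by apply/orP; right; apply: leq_trans IH _; rewrite leq_exp2r.
  have e := partnT (fact_gt0 n).
  rewrite -[leqRHS]e (@widen_partn (n`!)) // big_mkord.
  rewrite (bigID (fun i : 'I_(n`!.+1) => (i < n.+1)%N && prime i)) /=.
  apply: (@leq_trans (\prod_(i < (n`!).+1 | (i < n.+1)%N && prime i) i ^ logn i n`!)); last first.
    rewrite -{1}[X in (X <= _)%N]muln1 leq_mul //; last first.
      apply: prodn_cond_gt0 => i _; case: (posnP i) => [->|i0]; last by rewrite expn_gt0 i0.
      by rewrite lognE.
  have le : (n.+1 <= (n`!).+1)%N by rewrite ltnS fact_geq.
  rewrite (big_ord_widen_cond _ (fun i => prime i) (fun i => i ^ (n %/ i))%N le).
  rewrite [X in (X <= _)%N](eq_bigl (fun i : 'I_(n`!.+1) => (i < n.+1)%N && prime i)); last by move=> i; rewrite andbC.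
  apply: leq_prod => i /andP[lin pi]; apply: leq_pexp2l; first exact: prime_gt0.
  by rewrite logn_fact // big_ltn // expn1 leq_addr.
have hln : \sum_(p < n.+1 | prime p) (n %/ p)%:R * ln (p%:R : R) <= n%:R * ln n%:R.
  have -> : n%:R * ln (n%:R : R) = ln ((n ^ n)%:R).
    by rewrite natrX lnXn // mulr_natl.
  have -> : \sum_(p < n.+1 | prime p) (n %/ p)%:R * ln (p%:R : R) =
     ln ((\prod_(p < n.+1 | prime p) p ^ (n %/ p))%:R).
    rewrite natr_prod -[LHS]expRK expR_sum; congr ln; apply: eq_bigr => i pi.
    have i0 : (0 : R) < i%:R by rewrite ltr0n prime_gt0.
    by rewrite natrX -[in RHS](@lnK R i%:R) // -expRM_natl.
  rewrite ler_ln ?ler_nat // posrE ltr0n ?expn_gt0 ?n0 //.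
  by apply: prodn_cond_gt0 => i pi; rewrite expn_gt0 prime_gt0.
rewrite -(ler_pM2l nR) mulrCA.
apply: le_trans (ler_wpM2l _ hln); last by [].
rewrite !mulr_sumr; apply: ler_sum => i pi.
have i0 : (0 : R) < i%:R by rewrite ltr0n prime_gt0.
have lni : 0 <= ln (i%:R : R) by rewrite ln_ge0 // ler1n prime_gt0.
rewrite mulrCA mulrC [leRHS]mulrA ler_wpM2r //.
(* The constant 2 arises here: since [n %/ i >= 1], one has [n / i < n %/ i + 1 <= 2 * (n %/ i)]. *)
rewrite ler_pdivrMr // -!natrM ler_nat.
have i0' : (0 < i)%N by rewrite prime_gt0.
have := divn_eq n i; have := ltn_pmod n i0'.
have : (0 < n %/ i)%N by rewrite divn_gt0 // -ltnS.
nia.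
Qed.

(** A discrete comparison with the integral of [u ^ (-1 - t)]. The induction carries the sharper
    bound [1 + (1 - m ^ (-t)) / t]; its step is [t * u ^ (-1 - t) <= (u - 1) ^ (-t) - u ^ (-t)],
    which follows from [ln (1 - 1 / u) <= - 1 / u] and [expR v >= 1 + v]. *)
Lemma zeta_partial_le (R : realType) (t : R) (n : nat) : 0 < t ->
  \sum_(k < n) expR (- (1 + t) * ln k.+1%:R) <= 1 + t^-1.
Proof.
move=> t0.
suff H : forall m, \sum_(k < m.+1) expR (- (1 + t) * ln k.+1%:R) <=
    1 + t^-1 * (1 - expR (- t * ln (m.+1%:R : R))).
  case: n => [|m]; first by rewrite big_ord0 addr_ge0 // invr_ge0 ltW.
  apply: le_trans (H m) _; rewrite lerD2l ler_piMr ?invr_ge0 ?(ltW t0) //.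
  by rewrite gerBl expR_ge0.
elim=> [|m IH]; first by rewrite big_ord1 ln1 !mulr0 expR0 subrr mulr0 addr0.
rewrite big_ord_recr /=; apply: le_trans (lerD IH (lexx _)) _.
rewrite -addrA lerD2l -(ler_pM2l t0) mulrDr !mulrA divff ?gt_eqF // !mul1r.
set u : R := m.+2%:R; set v : R := m.+1%:R.
have u0 : 0 < u by rewrite ltr0n.
have v0 : 0 < v by rewrite ltr0n.
have uv : v = u - 1 by rewrite /u -natr1 addrK.
have -> : - (1 + t) * ln u = - t * ln u - ln u by ring.
rewrite expRD expRN lnK //.
have -> : - t * ln v = - t * ln u - t * (ln (v / u)) by rewrite ln_div //; ring.
rewrite expRD; set e := expR (- t * ln u).
have e0 : 0 < e by apply: expR_gt0.
have h1 : 1 + t / u <= expR (- (t * ln (v / u))).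
  apply: le_trans (expR_ge1Dx _); rewrite lerD2l -mulrN ler_pM2l //.
  have -> : v / u = 1 + (- u^-1) by rewrite uv mulrBl divff ?gt_eqF // mul1r.
  rewrite -[X in X <= _]opprK lerN2; apply: le_ln1Dx.
  by rewrite ltrN2 invf_lt1 // ltr1n.
have : e * (1 + t / u) <= e * expR (- (t * ln (v / u))) by rewrite ler_pM2l.
have -> : t * (e / u) = e * (t / u) by ring.
by rewrite mulrDr mulr1 => H; rewrite -addrA lerD2l addrC lerBlDr [leRHS]addrC lerBrDr addrC.
Qed.

(** Over all integers from 2 to [m] the product telescopes to [2 * m / (m + 1)], and the factors at
    composite numbers, absent here, exceed 1. *)
Lemma prod_sq_le2 (R : realType) (n : nat) :
  \prod_(p < n.+1 | prime p) ((p%:R : R) ^+ 2 / (p%:R ^+ 2 - 1)) <= 2.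
Proof.
case: n => [|n]; first by rewrite big1 ?ler1n // => i; rewrite (ord1 i).
suff H : \prod_(p < n.+2 | prime p) ((p%:R : R) ^+ 2 / (p%:R ^+ 2 - 1)) <=
    2 * n.+1%:R / n.+2%:R.
  apply: le_trans H _; rewrite ler_pdivrMr ?ltr0n // ler_pM2l ?ltr0n //.
  by rewrite ler_nat.
elim: n => [|n IH].
  by rewrite big_mkcond !big_ord_recl big_ord0 /= !mulr1 divff // pnatr_eq0.
rewrite big_mkcond big_ord_recr -big_mkcond /=.
set b : R := (if prime n.+2 then _ else _).
have b0 : 0 <= b by rewrite /b; case: ifP => // _; rewrite divr_ge0 ?sqr_ge0 // subr_ge0 -natrX ler1n.
apply: le_trans (ler_wpM2r b0 IH) _.
have nn : (0:R) <= n%:R by rewrite ler0n.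
have e2 : (n.+2%:R : R) = n%:R + 2 by rewrite -[n.+2]addn2 natrD.
have e1 : (n.+1%:R : R) = n%:R + 1 by rewrite -[n.+1]addn1 natrD.
have e3 : (n.+3%:R : R) = n%:R + 3 by rewrite -[n.+3]addn3 natrD.
rewrite /b; case: ifP => _; last first.
  rewrite mulr1 e1 e2 e3 ler_pdivrMr ?ltr_wpDl // mulrAC ler_pdivlMr ?ltr_wpDl //.
  nra.
rewrite le_eqVlt; apply/orP; left; apply/eqP; rewrite e1 e2 e3.
field.
by apply/and3P; split; rewrite gt_eqF //; nra.
Qed.


Lemma ler_sum_inj (R : numDomainType) (I J : finType) (f : I -> J) (F : J -> R) :
  injective f -> (forall j, 0 <= F j) -> \sum_i F (f i) <= \sum_j F j.
Proof.
move=> finj F0.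
rewrite [leRHS](bigID (mem [set f i | i : I])) /= big_imset /=; last by move=> i j _ _ /finj.
by rewrite lerDl sumr_ge0.
Qed.

Lemma dvdn_prod_primes (I : finType) (p : I -> nat) (K : {set I}) (i : I) :
  (forall i, prime (p i)) -> injective p ->
  (p i %| \prod_(j in K) p j)%N = (i \in K).
Proof.
move=> pp pinj; rewrite Euclid_dvd_prod //; apply/idP/idP.
  move=> /(big_rec (fun b : bool => b -> i \in K)); apply => // j b jK hb.
  by case/orP=> // ; rewrite dvdn_prime2 // => /eqP /pinj ->.
by move=> iK; rewrite (bigD1 i) //= dvdnn.
Qed.

Lemma prod_primes_inj (I : finType) (p : I -> nat) :
  (forall i, prime (p i)) -> injective p ->
  injective (fun K : {set I} => \prod_(j in K) p j)%N.
Proof.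
move=> pp pinj K K' e; apply/setP => i.
by rewrite -!(dvdn_prod_primes _ _ pp pinj) e.
Qed.

Lemma prodr_1D (R : comNzRingType) (I : finType) (F : I -> R) :
  \prod_i (1 + F i) = \sum_(K : {set I}) \prod_(i in K) F i.
Proof.
rewrite (eq_bigr (fun i => F i + 1)); last by move=> i _; rewrite addrC.
rewrite bigA_distr; apply: eq_big => // K _.
by rewrite [RHS]big_mkcond.
Qed.

(** Expanding the product gives a sum over squarefree integers, each occurring once, hence at most a
    partial sum of the zeta series at [1 + t]. The cutoff [X] is the product of all the primes
    involved; the index is the integer minus one. *)
Lemma euler_prod_le (R : realType) (t : R) (n : nat) : 0 < t ->
  \prod_(p < n.+1 | prime p) (1 + expR (- (1 + t) * ln (p%:R : R))) <= 1 + t^-1.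
Proof.
move=> t0.
pose I := {i : 'I_n.+1 | i \in [pred i : 'I_n.+1 | prime i]}.
pose p (i : I) : nat := val (val i).
have pp i : prime (p i) by exact: (valP i).
have pinj : injective p by move=> i j e; do 2 apply: val_inj.
rewrite (big_sub [pred i : 'I_n.+1 | prime i] (fun i : 'I_n.+1 => 1 + expR (- (1 + t) * ln i%:R))).
rewrite -/I prodr_1D.
pose X := (\prod_(i in [set: I]) p i)%N.
have n0 (K : {set I}) : (0 < \prod_(j in K) p j)%N by apply: prodn_gt0 => i; rewrite prime_gt0.
have fX (K : {set I}) : ((\prod_(j in K) p j).-1 < X)%N.
  rewrite prednK // /X dvdn_leq ?n0 //.
  by rewrite [X in (_ %| X)%N](big_setID K) /= setTI dvdn_mulr.
pose f (K : {set I}) : 'I_X := Ordinal (fX K).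
have finj : injective f.
  move=> K K' /(congr1 val) /= e; apply: (prod_primes_inj pp pinj).
  by rewrite -(prednK (n0 K)) -(prednK (n0 K')) e.
apply: le_trans (zeta_partial_le X t0).
rewrite (eq_bigr (fun K => expR (- (1 + t) * ln (f K).+1%:R))); last first.
  move=> K _ /=; rewrite prednK //.
  rewrite -expR_sum -mulr_sumr; congr (expR (_ * _)).
  rewrite natr_prod -[LHS]expRK expR_sum; congr ln; apply: eq_bigr => i _.
  by rewrite lnK // posrE ltr0n prime_gt0 // pp.
apply: (@ler_sum_inj _ _ _ f (fun k : 'I_X => expR (- (1 + t) * ln k.+1%:R))) => // k.
exact: expR_ge0.
Qed.

(** Rankin's trick with [t = 1 / ln n]. Write [p / (p - 1)] as [p ^ 2 / (p ^ 2 - 1) * (1 + 1 / p)]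
    and bound [1 + 1 / p] by [(1 + p ^ (-1 - t)) * expR (t * ln p / p)]. The three resulting
    products are at most [2], [1 + ln n] and [expR 2]. *)
Lemma mertens_prod_le (R : realType) (n : nat) : (1 < n)%N ->
  \prod_(p < n.+1 | prime p) ((p%:R : R) / (p%:R - 1)) <=
  2 * expR 2 * (1 + ln n%:R).
Proof.
move=> n1; pose L : R := ln n%:R.
have L0 : 0 < L by rewrite ln_gt0 // ltr1n.
pose t := L^-1; have t0 : 0 < t by rewrite invr_gt0.
have step : \prod_(p < n.+1 | prime p) ((p%:R : R) / (p%:R - 1)) <=
   \prod_(p < n.+1 | prime p) ((p%:R : R) ^+ 2 / (p%:R ^+ 2 - 1) *
    (1 + expR (- (1 + t) * ln (p%:R : R))) * expR (t * (ln p%:R / p%:R))).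
  apply: ler_prod => p pp.
  have p2 : (2 : R) <= p%:R by rewrite ler_nat prime_gt1.
  have p0 : (0 : R) < p%:R by lra.
  rewrite divr_ge0 ?ler0n //=; last by lra.
  have -> : (p%:R : R) / (p%:R - 1) = p%:R ^+ 2 / (p%:R ^+ 2 - 1) * (1 + p%:R^-1).
    field; apply/and3P; split; rewrite gt_eqF //; nra.
  rewrite -[leRHS]mulrA ler_wpM2l ?divr_ge0 ?sqr_ge0 //; first by nra.
  have -> : - (1 + t) * ln (p%:R : R) = - ln p%:R - t * ln p%:R by ring.
  rewrite expRD expRN lnK //; set q : R := p%:R^-1.
  have q0 : 0 < q by rewrite invr_gt0.
  have lnp : 0 <= ln (p%:R : R) by rewrite ln_ge0 //; lra.
  set e := expR _; set E := expR _.
  have e0 : 0 < e by apply: expR_gt0.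
  have h1 : 1 - t * ln (p%:R : R) <= e by apply: expR_ge1Dx.
  have h2 : 1 + t * (ln p%:R * q) <= E by apply: expR_ge1Dx.
  have h3 : 0 <= t * ln (p%:R : R) by rewrite mulr_ge0 // ltW.
  move: h2; rewrite mulrA; move: h1 h3; move: (t * ln _) => v h1 h3 h2.
  apply: (@le_trans _ _ ((1 + q * e) * (1 + v * q))).
    have : q * (1 - v) <= q * e by rewrite ler_pM2l.
    have : 0 <= q * e * (v * q) by rewrite !mulr_ge0 // ltW.
    rewrite mulrDl mul1r mulrDr mulr1.
    nra.
  by rewrite ler_wpM2l // addr_ge0 // mulr_ge0 // ltW.
apply: le_trans step _; rewrite 2!big_split /=.
have a0 : 0 <= \prod_(i < n.+1 | prime i) (i%:R ^+ 2 / (i%:R ^+ 2 - 1) : R).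
  apply: prodr_ge0 => i pi; rewrite divr_ge0 ?sqr_ge0 // subr_ge0 -natrX ler1n.
  by rewrite expn_gt0 prime_gt0.
have b0 : 0 <= \prod_(i < n.+1 | prime i) (1 + expR (- (1 + t) * ln (i%:R : R))).
  by apply: prodr_ge0 => i _; rewrite addr_ge0 ?expR_ge0.
have hb := euler_prod_le n t0.
have ha := prod_sq_le2 R n.
have hc : \prod_(i < n.+1 | prime i) expR (t * (ln i%:R / i%:R)) <= expR 2 :> R.
  rewrite -expR_sum ler_expR -mulr_sumr.
  apply: le_trans (ler_wpM2l (ltW t0) (prime_mul_ln_le R (ltnW n1))) _.
  by rewrite -/L mulrCA mulVf ?gt_eqF // mulr1.
have c0 : 0 <= \prod_(i < n.+1 | prime i) expR (t * (ln i%:R / i%:R)) :> R.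
  by apply: prodr_ge0 => i _; apply: expR_ge0.
rewrite /t invrK in hb.
apply: le_trans (ler_pM (mulr_ge0 a0 b0) c0 (ler_pM a0 b0 ha hb) hc) _.
by rewrite mulrAC.
Qed.


(** * The lower bound for the Selberg sum *)

Lemma ln_le_harmonic (R : realType) (n : nat) :
  ln (n.+1%:R : R) <= \sum_(k < n) (k.+1%:R)^-1.
Proof.
elim: n => [|n IH]; first by rewrite ln1 big_ord0.
rewrite big_ord_recr /=.
have n0 : (0 : R) < n.+1%:R by rewrite ltr0n.
have -> : (n.+2%:R : R) = n.+1%:R * (1 + n.+1%:R^-1).
  by rewrite mulrDr mulr1 divff ?gt_eqF // -natr1.
rewrite lnM ?posrE //; last by rewrite addr_gt0 // invr_gt0.
by rewrite lerD // le_ln1Dx // (@lt_le_trans _ _ 0) // ?invr_ge0 ?ltrN10 // ltW.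
Qed.

Lemma geometric_sumE (R : comNzRingType) (x : R) (n : nat) :
  (1 - x) * \sum_(e < n) x ^+ e = 1 - x ^+ n.
Proof.
elim: n => [|n IH]; first by rewrite big_ord0 mulr0 expr0 subrr.
by rewrite big_ord_recr /= mulrDr IH exprS; ring.
Qed.

Lemma geometric_sum_le (R : numFieldType) (x : R) (n : nat) :
  0 <= x < 1 -> \sum_(e < n) x ^+ e <= (1 - x)^-1.
Proof.
case/andP=> x0 x1; rewrite -(ler_pM2l (x := 1 - x)) ?subr_gt0 //.
rewrite geometric_sumE divff ?gt_eqF ?subr_gt0 //.
by rewrite gerBl exprn_ge0.
Qed.

Lemma geometric_tail_le (R : numFieldType) (x : R) (n : nat) :
  0 <= x < 1 -> \sum_(e < n | e != 0%N :> nat) x ^+ e <= x / (1 - x).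
Proof.
case: n => [|n] hx; case/andP: (hx) => x0 x1.
  by rewrite big_ord0 divr_ge0 // subr_ge0 ltW.
rewrite big_mkcond big_ord_recl /= add0r.
rewrite (eq_bigr (fun e : 'I_n => x * x ^+ e)); last by move=> e _; rewrite -exprS.
by rewrite -mulr_sumr ler_wpM2l // geometric_sum_le.
Qed.


Local Notation "'primes_in' z y" :=
  {i : 'I_y.+1 | i \in [pred i : 'I_y.+1 | prime i && (z < i)%N]}
  (at level 10, z at level 8, y at level 8).

Lemma primes_inP (z y : nat) (i : primes_in z y) :
  [/\ prime (val (val i)), (z < val (val i))%N & (val (val i) <= y)%N].
Proof.
by move: (valP i); rewrite inE => /andP[? ?]; split=> //; rewrite -ltnS ltn_ord.
Qed.

Lemma prod_logn (z y n : nat) : (0 < n <= y)%N ->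
  n = ((\prod_(i : primes_in z y) val (val i) ^ logn (val (val i)) n) *
       \prod_(q < y.+1 | prime q && ~~ (z < q)%N) q ^ logn q n)%N.
Proof.
case/andP=> n0 ny.
rewrite -(big_sub [pred i : 'I_y.+1 | prime i && (z < i)%N] (fun i : 'I_y.+1 => i ^ logn i n)%N).
rewrite -[LHS](partnT n0) (@widen_partn y) // big_mkord.
rewrite (bigID (fun i : 'I_y.+1 => prime i)) /= [X in (_ * X)%N]big1 ?muln1; last first.
  by move=> i; move=> hi; rewrite lognE (negbTE hi).
rewrite (bigID (fun i : 'I_y.+1 => (z < i)%N)) /=.
by congr (_ * _)%N; apply: eq_bigl => i; rewrite !inE.
Qed.

(** Each [k <= y] splits into a part with primes in [(z, y]] and a part with primes up to [z].
    Summing [1 / k] over all exponents, a prime [q <= z] yields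
    [\sum_(e >= 0) q ^ (-e) = q / (q - 1)], and a prime [p] of the support [K] of the first part
    yields [\sum_(e >= 1) p ^ (-e) = 1 / (p - 1)]. The product of the support divides [k], so it is
    at most [y]. *)
Lemma selberg_sum_ge (R : realType) (z y : nat) : (z <= y)%N ->
  ln (y.+1%:R : R) <=
  (\prod_(q < z.+1 | prime q) ((q%:R : R) / (q%:R - 1))) *
  \sum_(K : {set primes_in z y} | (\prod_(i in K) val (val i) <= y)%N)
     \prod_(i in K) ((val (val i))%:R - 1)^-1.
Proof.
move=> zy; apply: le_trans (ln_le_harmonic R y) _.
set I := sig _; pose p (i : I) : nat := val (val i).
pose small (q : nat) := prime q && ~~ (z < q)%N.
have pp i : prime (p i) by case: (primes_inP i).
pose supp (f : {ffun I -> 'I_y.+1}) := [set i | f i != 0%N :> nat].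
pose good (K : {set I}) := (\prod_(i in K) p i <= y)%N.
pose a (f : {ffun I -> 'I_y.+1}) : R := \prod_i ((p i)%:R^-1) ^+ f i.
(* The exponents of the small primes are stored as a function on all of ['I_y.+1]. Off the small
   primes only the exponent 0 has nonzero weight, so those indices contribute a factor 1. *)
pose b (g : {ffun 'I_y.+1 -> 'I_y.+1}) : R :=
  \prod_(i < y.+1) (if small i then (i%:R^-1) ^+ g i else if g i == 0%N :> nat then 1 else 0).
have a0 f : 0 <= a f by apply: prodr_ge0 => i _; rewrite exprn_ge0 // invr_ge0.
have b0 g : 0 <= b g.
  apply: prodr_ge0 => i _; case: ifP => _; last by case: ifP.
  by rewrite exprn_ge0 // invr_ge0.
pose F (x : {ffun I -> 'I_y.+1} * {ffun 'I_y.+1 -> 'I_y.+1}) : R :=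
  if good (supp x.1) then a x.1 * b x.2 else 0.
have lE (k : 'I_y) q : (logn q k.+1 < y.+1)%N.
  by apply: leq_trans (ltn_logl q (ltn0Sn k)) _; rewrite ltnW // ltnS.
pose f (k : 'I_y) : {ffun I -> 'I_y.+1} * {ffun 'I_y.+1 -> 'I_y.+1} :=
  ([ffun i => Ordinal (lE k (p i))],
   [ffun q : 'I_y.+1 => if small q then Ordinal (lE k q) else ord0]).
have nE (k : 'I_y) : k.+1 = ((\prod_i p i ^ (f k).1 i) *
    \prod_(q : 'I_y.+1 | small q) q ^ (f k).2 q)%N.
  rewrite [LHS](@prod_logn z y k.+1); last by rewrite /= ltn_ord.
  congr (_ * _)%N.
    by apply: eq_bigr => i _; rewrite ffunE.
  by apply: eq_bigr => i hi; rewrite ffunE /small hi.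
(* Unique factorisation: [nE] recovers [k] from its exponent vectors. *)
have finj : injective f.
  by move=> j k' e; apply: val_inj; apply: succn_inj; rewrite nE e -nE.
have smallq_gt0 q : small q -> (0 < q)%N by case/andP=> /prime_gt0.
have FE (k : 'I_y) : (k.+1%:R : R)^-1 = F (f k).
  rewrite /F; have -> : good (supp (f k).1).
    rewrite /good; apply: (@leq_trans k.+1) => //; rewrite [leqRHS](nE k).
    apply: (@leq_trans (\prod_i p i ^ (f k).1 i)); last first.
      rewrite leq_pmulr //; apply: prodn_cond_gt0 => q sq.
      by rewrite expn_gt0 smallq_gt0.
    rewrite [leqLHS]big_mkcond; apply: leq_prod => i _; rewrite inE.
    case: ifP => h; last by rewrite expn_gt0 prime_gt0 ?pp.
    by rewrite -[leqLHS]expn1 leq_pexp2l ?(prime_gt0 (pp i)) ?lt0n.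
  rewrite [in LHS](nE k) natrM invfM natr_prod -prodfV natr_prod -prodfV.
  congr (_ * _); first by apply: eq_bigr => i _; rewrite natrX exprVn.
  rewrite big_mkcond; apply: eq_bigr => q _; case: ifP => sq.
    by rewrite natrX exprVn.
  by rewrite ffunE sq.
rewrite (eq_bigr (fun k => F (f k))); last by move=> k _; rewrite FE.
apply: le_trans (ler_sum_inj finj _) _.
  by move=> x; rewrite /F; case: ifP => // _; rewrite mulr_ge0.
have -> : \sum_x F x = (\sum_g b g) * \sum_(h | good (supp h)) a h.
  rewrite mulrC big_distrlr /= pair_big_dep /= [RHS]big_mkcond.
  by apply: eq_bigr => x _; rewrite /F andbT.
apply: ler_pM; [exact: sumr_ge0|exact: sumr_ge0| |].
  rewrite -(bigA_distr_bigA (fun (i : 'I_y.+1) (e : 'I_y.+1) => if small i then (i%:R^-1) ^+ e else if e == 0%N :> nat then 1 else 0 : R)).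
  rewrite (big_ord_widen_cond y.+1 (fun i => prime i) (fun i => (i%:R : R) / (i%:R - 1))) //.
  rewrite [leRHS]big_mkcond; apply: ler_prod => i _.
  have -> : prime i && (i < z.+1)%N = small i by rewrite /small -leqNgt ltnS.
  rewrite sumr_ge0 /=; last first.
    by move=> e _; case: ifP => _; [rewrite exprn_ge0 // invr_ge0|case: ifP].
  case: ifP => si; last first.
    by rewrite -big_mkcond /= (bigD1 ord0) //= big1 ?addr0 // => e /andP[/eqP h1 /eqP]; case; apply: val_inj.
  have i2 : (2 : R) <= i%:R by rewrite ler_nat prime_gt1 //; case/andP: si.
  have i0 : (0 : R) < i%:R by lra.
  apply: le_trans (geometric_sum_le _ _) _.
    by rewrite invr_ge0 ltW //= invf_lt1 //; lra.
  by rewrite le_eqVlt; apply/orP; left; apply/eqP; field; apply/andP; split; rewrite gt_eqF //; lra.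
rewrite (partition_big supp good) //; apply: ler_sum => K gK.
apply: (@le_trans _ _ (\sum_(h : {ffun I -> 'I_y.+1}) \prod_i
   (if ((h i != 0%N :> nat) == (i \in K)) then ((p i)%:R^-1) ^+ h i else 0))).
  rewrite big_mkcond; apply: ler_sum => h _; case: ifP => [/andP[_ /eqP sK]|_].
    by apply: ler_prod => i _; rewrite exprn_ge0 ?invr_ge0 //= -sK inE eqxx.
  by apply: prodr_ge0 => i _; case: ifP => // _; rewrite exprn_ge0 ?invr_ge0.
rewrite -(bigA_distr_bigA (fun (i : I) (e : 'I_y.+1) => if (e != 0%N :> nat) == (i \in K) then ((p i)%:R^-1) ^+ e else 0 : R)).
rewrite [leRHS]big_mkcond; apply: ler_prod => i _.
rewrite sumr_ge0 /=; last by move=> e _; case: ifP => // _; rewrite exprn_ge0 // invr_ge0.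
have i2 : (2 : R) <= (p i)%:R by rewrite ler_nat prime_gt1.
have i0 : (0 : R) < (p i)%:R by lra.
rewrite -big_mkcond /=; case: ifP => iK.
  rewrite (eq_bigl (fun e : 'I_y.+1 => e != 0%N :> nat)); last by move=> e; rewrite eqb_id.
  apply: le_trans (geometric_tail_le _ _) _.
    by rewrite invr_ge0 ltW //= invf_lt1 //; lra.
  by rewrite le_eqVlt; apply/orP; left; apply/eqP; field; apply/andP; split; rewrite gt_eqF //; lra.
rewrite (eq_bigl (fun e : 'I_y.+1 => e == 0%N :> nat)); last by move=> e; rewrite eqbF_neg negbK.
by rewrite (bigD1 ord0) //= big1 ?addr0 // => e /andP[/eqP h1 /eqP]; case; apply: val_inj.
Qed.


(** * The squared sieve weight and its coordinates *)

(* The local factor [- c_m(s - n) / phi(m)], [c_m] the Ramanujan sum of a prime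
   modulus [m]. *)
Definition psi {R : realFieldType} (m s n : nat) : R :=
  if s == n %[mod m] then -1 else (m%:R - 1)^-1.

(* The square of [psi m] is an affine function of [psi m]: [psi_const] and
   [psi_coef] are the coordinates of [psi m ^+ (b + b')] on [1] and [psi m]. *)
Definition psi_const {R : realFieldType} (m : nat) (b b' : bool) : R :=
  if b then (if b' then (m%:R - 1)^-1 else 0) else (if b' then 0 else 1).

Definition psi_coef {R : realFieldType} (m : nat) (b b' : bool) : R :=
  if b then (if b' then - (m%:R - 2) / (m%:R - 1) else 1) else (if b' then 1 else 0).

Lemma psi_mulE (R : realFieldType) (m s n : nat) (b b' : bool) : (1 < m)%N ->
  (if b then psi m s n else 1) * (if b' then psi m s n else 1) =
  psi_coef m b b' * psi m s n + psi_const m b b' :> R.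
Proof.
move=> m1; have m2 : (2 : R) <= m%:R by rewrite ler_nat.
rewrite /psi_coef /psi_const; case: b; case: b'; rewrite ?mulr1 ?mul1r ?addr0 ?mul0r ?add0r //.
by rewrite /psi; case: ifP => _; field; apply: lt0r_neq0; lra.
Qed.

(* The coordinates of the squared Selberg weight on the products of the [psi]. *)
Definition sieve_coef {R : realFieldType} (I : finType) (p : I -> nat) (D : {set {set I}}) (Q : {set I}) : R :=
  \sum_(K in D) \sum_(K' in D) \prod_i
    (if i \in Q then psi_coef (p i) (i \in K) (i \in K')
     else psi_const (p i) (i \in K) (i \in K')).

Lemma sieve_sqrE (R : realFieldType) (I : finType) (p : I -> nat) (D : {set {set I}}) (s n : nat) :
  (forall i, prime (p i)) ->
  (\sum_(K in D) \prod_(i in K) psi (p i) s n) ^+ 2 =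
  \sum_Q sieve_coef p D Q * \prod_(i in Q) psi (p i) s n :> R.
Proof.
move=> pp; rewrite expr2 big_distrlr /=.
under [RHS]eq_bigr => Q _ do rewrite mulr_suml.
rewrite [RHS]exchange_big /=; apply: eq_bigr => K _.
under [RHS]eq_bigr => Q _ do rewrite mulr_suml.
rewrite [RHS]exchange_big /=; apply: eq_bigr => K' _.
rewrite big_mkcond [X in _ * X]big_mkcond -big_split /=.
under eq_bigr => i _ do rewrite psi_mulE ?prime_gt1 //.
rewrite bigA_distr; apply: eq_big => // Q _.
rewrite [X in _ * X]big_mkcond -big_split /=.
by apply: eq_bigr => i _; case: ifP => _; rewrite ?mulr1.
Qed.

(** [psi_const] vanishes when its two flags differ, so only the pairs [K = K'] survive. This is the
    mean value [L] of the squared weight. *)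
Lemma sieve_coef0 (R : realFieldType) (I : finType) (p : I -> nat) (D : {set {set I}}) :
  sieve_coef p D set0 = \sum_(K in D) \prod_(i in K) ((p i)%:R - 1)^-1 :> R.
Proof.
apply: eq_bigr => K KD; rewrite (bigD1 K) //= [X in _ + X]big1 ?addr0.
  by rewrite [RHS]big_mkcond; apply: eq_bigr => i _; rewrite inE /psi_const; case: (i \in K).
move=> K' /andP[_ ne].
have [i hi] : exists i, (i \in K) != (i \in K').
  apply/existsP; rewrite -negb_forall; apply: contra ne => /forallP h.
  by apply/eqP/setP => i; apply/esym/eqP.
rewrite (bigD1 i) //= inE /psi_const.
by case: (i \in K) hi; case: (i \in K') => //; rewrite mul0r.
Qed.

Lemma leq_prod_setU (I : finType) (p : I -> nat) (K K' : {set I}) :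
  (forall i, 0 < p i)%N ->
  (\prod_(i in K :|: K') p i <= \prod_(i in K) p i * \prod_(i in K') p i)%N.
Proof.
move=> p0; rewrite big_mkcond [X in (X * _)%N]big_mkcond [X in (_ * X)%N]big_mkcond -big_split /=.
apply: leq_prod => i _; rewrite inE; have pi := p0 i.
case: (i \in K); case: (i \in K') => //=; rewrite ?muln1 ?mul1n //.
by rewrite leq_pmulr.
Qed.

Lemma leq_prod_subset (I : finType) (p : I -> nat) (K K' : {set I}) :
  (forall i, 0 < p i)%N -> K \subset K' ->
  (\prod_(i in K) p i <= \prod_(i in K') p i)%N.
Proof.
move=> p0 sK; rewrite big_mkcond [leqRHS]big_mkcond; apply: leq_prod => i _.
by case: ifP => [/(subsetP sK) ->|_] //; case: ifP.
Qed.

(** A prime of [Q] outside [K :|: K'] brings the factor [psi_coef _ false false = 0], so some pair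
    satisfies [Q \subset K :|: K']. *)
Lemma sieve_coef_neq0 (R : realFieldType) (I : finType) (p : I -> nat) (D : {set {set I}}) (Q : {set I}) (y : nat) :
  (forall i, prime (p i)) ->
  (forall K, K \in D -> (\prod_(i in K) p i <= y)%N) ->
  sieve_coef p D Q != 0 :> R -> (\prod_(i in Q) p i <= y ^ 2)%N.
Proof.
move=> pp hD hc; case: leqP => // hlt; exfalso; move/negP: hc; apply; apply/eqP.
rewrite /sieve_coef big1 // => K KD; rewrite big1 // => K' K'D.
apply/eqP; rewrite prodf_seq_eq0; apply/hasP.
have [i iQ /norP[iK iK']] : exists2 i, i \in Q & ~~ ((i \in K) || (i \in K')).
  have : ~~ (Q \subset K :|: K').
    apply: contraL hlt => sQ; rewrite -leqNgt.
    have p0 i : (0 < p i)%N by rewrite prime_gt0.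
    apply: leq_trans (leq_prod_subset p0 sQ) _.
    apply: leq_trans (leq_prod_setU K K' p0) _.
    by rewrite expnS expn1 leq_mul // hD.
  by case/subsetPn=> i iQ; rewrite inE => h; exists i.
exists i; first by rewrite mem_index_enum.
by rewrite iQ /psi_coef (negbTE iK) (negbTE iK') /=.
Qed.

Lemma sum_pair_prod (R : comNzRingType) (I : finType) (g : I -> bool -> bool -> R) :
  \sum_(K : {set I}) \sum_(K' : {set I}) \prod_i g i (i \in K) (i \in K') =
  \prod_i (g i true true + g i true false + (g i false true + g i false false)).
Proof.
rewrite bigA_distr; apply: eq_big => // K _.
rewrite (eq_bigr (fun i => g i (i \in K) true + g i (i \in K) false)); last first.
  by move=> i _; case: (i \in K).
rewrite bigA_distr; apply: eq_big => // K' _.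
by apply: eq_bigr => i _; case: (i \in K').
Qed.

(** Once absolute values are taken, the sum may be extended from [D] to all pairs of sets, where it
    factorises. With [q = 1 / (p - 1)], the local factor is [(1 - q) + 1 + 1 <= 3] for a prime in
    [Q] and [1 + q] for the others. *)
Lemma sieve_coef_le (R : realFieldType) (I : finType) (p : I -> nat) (D : {set {set I}}) (Q : {set I}) :
  (forall i, prime (p i)) ->
  `|sieve_coef p D Q| <= 3 ^+ #|Q| * \prod_i (1 + ((p i)%:R - 1)^-1) :> R.
Proof.
move=> pp.
have p2 i : (2 : R) <= (p i)%:R by rewrite ler_nat prime_gt1.
pose g i b b' : R := `|if i \in Q then psi_coef (p i) b b' else psi_const (p i) b b'|.
have g0 K K' : 0 <= \prod_i g i (i \in K) (i \in K') by apply: prodr_ge0 => i _; exact: normr_ge0.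
apply: (@le_trans _ _ (\sum_(K : {set I}) \sum_(K' : {set I}) \prod_i g i (i \in K) (i \in K'))).
  apply: le_trans (ler_norm_sum _ _ _) _.
  rewrite big_mkcond; apply: ler_sum => K _; case: ifP => _; last exact: sumr_ge0.
  apply: le_trans (ler_norm_sum _ _ _) _.
  rewrite big_mkcond; apply: ler_sum => K' _; case: ifP => _ //.
  by rewrite normr_prod.
rewrite sum_pair_prod.
have -> : (3 : R) ^+ #|Q| = \prod_i (if i \in Q then 3 else 1).
  by rewrite -big_mkcond /= prodr_const.
rewrite -big_split /=; apply: ler_prod => i _.
rewrite !addr_ge0 ?normr_ge0 //= /g.
have q0 : 0 < (((p i)%:R - 1)^-1 : R) by rewrite invr_gt0; have := p2 i; lra.
rewrite /psi_coef /psi_const; case: (i \in Q); rewrite ?normr0 ?normr1 ?addr0 ?add0r.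
  have -> : - ((p i)%:R - 2) / ((p i)%:R - 1) = ((p i)%:R - 1)^-1 - 1 :> R.
    by field; apply: lt0r_neq0; have := p2 i; lra.
  have : ((p i)%:R - 1)^-1 <= 1 :> R by rewrite invf_le1; have := p2 i; lra.
  move: q0; move: (_^-1) => q q0 q1.
  by rewrite ler0_norm; lra.
by rewrite gtr0_norm // mul1r addrC.
Qed.


(** * Complete sums by the Chinese remainder theorem, and correlations of [psi] *)

Lemma sum_mul_coprime (R : comNzRingType) (m d : nat) (f g : nat -> R) :
  (0 < m)%N -> (0 < d)%N -> coprime m d ->
  (forall n, f (n %% m)%N = f n) -> (forall n, g (n %% d)%N = g n) ->
  \sum_(n < m * d) f n * g n = (\sum_(n < m) f n) * (\sum_(n < d) g n).
Proof.
move=> m0 d0 cmd hf hg.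
pose h (n : 'I_(m * d)) : 'I_m * 'I_d :=
  (Ordinal (ltn_pmod n m0), Ordinal (ltn_pmod n d0)).
have hinj : injective h.
  move=> a b [e1 e2]; apply: val_inj => /=.
  rewrite -(modn_small (ltn_ord a)) -(modn_small (ltn_ord b)).
  by apply/eqP; rewrite chinese_remainder // e1 e2 !eqxx.
have hbij : bijective h by apply: inj_card_bij => //; rewrite card_prod !card_ord.
rewrite big_distrlr /= pair_big /= (reindex h) /=; last exact: onW_bij.
by apply: eq_bigr => n _; rewrite hf hg.
Qed.

Lemma coprime_prod_primes (I : eqType) (p : I -> nat) (i : I) (r : seq I) :
  (forall i, prime (p i)) -> injective p -> i \notin r ->
  coprime (p i) (\prod_(j <- r) p j)%N.
Proof.
move=> pp pinj ir; rewrite prime_coprime // Euclid_dvd_prod // big_has.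
apply/hasPn => j jr.
by rewrite dvdn_prime2 //; apply: contra ir => /eqP /pinj ->.
Qed.

Lemma sum_prod_primes (R : comNzRingType) (I : finType) (p : I -> nat)
    (g : I -> nat -> R) (Q : {set I}) :
  (forall i, prime (p i)) -> injective p ->
  (forall i n, g i (n %% p i)%N = g i n) ->
  \sum_(n < \prod_(i in Q) p i) \prod_(i in Q) g i n =
  \prod_(i in Q) \sum_(n < p i) g i n.
Proof.
move=> pp pinj hg; rewrite -!(big_enum _ _ (mem Q)) /=.
under eq_bigr do rewrite -(big_enum _ _ (mem Q)) /=.
have := enum_uniq Q; elim: (enum Q) => [|i r IH].
  by rewrite !big_nil big_ord1 big_nil.
rewrite /= => /andP[ir ur]; rewrite !big_cons.
under eq_bigr do rewrite big_cons.
have p0 j : (0 < p j)%N by rewrite prime_gt0.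
have P0 : (0 < \prod_(j <- r) p j)%N by apply: prodn_gt0.
have cop := coprime_prod_primes pp pinj ir.
have per n : \prod_(j <- r) g j (n %% \prod_(j <- r) p j)%N = \prod_(j <- r) g j n.
  rewrite big_seq [RHS]big_seq; apply: eq_bigr => j jr.
  rewrite -hg modn_dvdm ?hg //.
  by rewrite (big_rem j) //= dvdn_mulr.
rewrite -IH //.
exact: (@sum_mul_coprime _ _ _ (g i) (fun n => \prod_(j <- r) g j n) (p0 i) P0 cop (hg i) per).
Qed.

(** Strong induction on [N] removes one full period at a time; the final incomplete period is
    bounded trivially by [P]. *)
Lemma periodic_sum_le (R : numDomainType) (G : nat -> R) (P : nat) (w : R) (N : nat) :
  (0 < P)%N -> 0 <= w -> (forall n, `|G n| <= 1) -> (forall n, G (P + n)%N = G n) ->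
  `|\sum_(n < P) G n| <= P%:R * w ->
  `|\sum_(n < N) G n| <= P%:R + N%:R * w.
Proof.
move=> P0 w0 G1 GP hP; elim/ltn_ind: N => N IH.
case: (leqP N P) => NP.
  apply: (@le_trans _ _ P%:R); last by rewrite lerDl mulr_ge0.
  apply: le_trans (ler_norm_sum _ _ _) _.
  apply: (@le_trans _ _ (\sum_(i < N) 1)); first exact: ler_sum.
  by rewrite sumr_const card_ord ler_nat.
have -> : N = (P + (N - P))%N by rewrite subnKC // ltnW.
rewrite big_split_ord /=; apply: le_trans (ler_normD _ _) _.
under [X in _ + `|X|]eq_bigr do rewrite GP.
have hlt : (N - P < N)%N by rewrite ltn_subrL P0 (leq_ltn_trans _ NP).
rewrite natrD mulrDl addrCA; apply: lerD; first exact: hP.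
exact: IH.
Qed.

(* Up to sign, the mean over [n] of [psi m s n * psi m s' n]. *)
Definition psi_corr {R : realFieldType} (m s s' : nat) : R :=
  if s == s' %[mod m] then (m%:R - 1)^-1 else (m%:R - 1)^-1 ^+ 2.

Lemma psi_modr (R : realFieldType) (m s n : nat) : psi m s (n %% m)%N = psi m s n :> R.
Proof. by rewrite /psi modn_mod. Qed.

Lemma psiE (R : realFieldType) (m s n : nat) :
  psi m s n = (m%:R - 1)^-1 + (- 1 - (m%:R - 1)^-1) * (s == n %[mod m])%:R :> R.
Proof. by rewrite /psi; case: ifP => _; rewrite ?mulr1 ?mulr0; ring. Qed.

Lemma sum_eq_mod (R : realFieldType) (m s : nat) : (0 < m)%N ->
  \sum_(n < m) (s == n %[mod m])%:R = 1 :> R.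
Proof.
move=> m0; rewrite (bigD1 (Ordinal (ltn_pmod s m0))) //= modn_mod eqxx big1 ?addr0 //.
move=> i /eqP hi; case: eqP => // e; exfalso; apply: hi; apply: val_inj => /=.
by rewrite e modn_small.
Qed.

Lemma sum_psi (R : realFieldType) (m s : nat) : (1 < m)%N ->
  \sum_(n < m) psi m s n = 0 :> R.
Proof.
move=> m1; have m2 : (2 : R) <= m%:R by rewrite ler_nat.
under eq_bigr do rewrite psiE.
rewrite big_split /= sumr_const card_ord -mulr_sumr (sum_eq_mod _ _ (ltnW m1)) -mulr_natl.
by field; apply: lt0r_neq0; lra.
Qed.

Lemma sum_psi_mul (R : realFieldType) (m s s' : nat) : (1 < m)%N ->
  `|\sum_(n < m) psi m s n * psi m s' n| = m%:R * psi_corr m s s' :> R.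
Proof.
move=> m1; have m2 : (2 : R) <= m%:R by rewrite ler_nat.
have q0 : 0 < ((m%:R - 1)^-1 : R) by rewrite invr_gt0; lra.
rewrite /psi_corr; case: ifP => [/eqP e|ne].
  have -> : \sum_(n < m) psi m s n * psi m s' n = m%:R * (m%:R - 1)^-1 :> R.
    under eq_bigr => n _ do rewrite -[psi m s' n]/(if _ == _ then _ else _) -e -/(psi m s n) (psi_mulE _ _ _ true true) //.
    by rewrite big_split /= -mulr_sumr sum_psi // mulr0 add0r sumr_const card_ord mulr_natl.
  by rewrite ger0_norm // mulr_ge0 // ltW.
rewrite -[RHS]gtr0_norm; last by rewrite mulr_gt0 ?exprn_gt0 //; lra.
rewrite -[RHS]normrN; congr `|_|.
pose q : R := (m%:R - 1)^-1.
(* As [s] and [s'] differ modulo [m], the product of the two indicators vanishes, and the expression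
   is linear in them. *)
have E n : psi m s n * psi m s' n = q ^+ 2 + q * (- 1 - q) * (s == n %[mod m])%:R
     + q * (- 1 - q) * (s' == n %[mod m])%:R :> R.
  rewrite !psiE -/q; case: eqP => [e1|_]; case: eqP => [e2|_]; rewrite ?mulr0 ?mulr1; try ring.
  by move: ne; rewrite e1 e2 eqxx.
under eq_bigr do rewrite E.
rewrite !big_split /= sumr_const card_ord -!mulr_sumr !(sum_eq_mod _ _ (ltnW m1)) -mulr_natl.
by rewrite /q; field; apply: lt0r_neq0; lra.
Qed.

Lemma psi_norm_le1 (R : realFieldType) (m s n : nat) : (1 < m)%N -> `|psi m s n : R| <= 1.
Proof.
move=> m1; have m2 : (2 : R) <= m%:R by rewrite ler_nat.
rewrite /psi; case: ifP => _; first by rewrite normrN1.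
by rewrite ger0_norm ?invr_ge0 ?invf_le1; lra.
Qed.

(** The summand has period the product of the primes in [Q :|: Q'], and its full sum factorises over
    them. A prime lying in exactly one of the two sets contributes the zero sum [sum_psi]; if
    [Q = Q'], every prime contributes a correlation. *)
Lemma sum_psi_prod_le (R : realFieldType) (I : finType) (p : I -> nat) (Q Q' : {set I}) (s s' N : nat) :
  (forall i, prime (p i)) -> injective p ->
  `|\sum_(n < N) (\prod_(i in Q) psi (p i) s n) * (\prod_(i in Q') psi (p i) s' n)| <=
  (\prod_(i in Q) p i * \prod_(i in Q') p i)%:R +
  N%:R * (if Q == Q' then \prod_(i in Q) psi_corr (p i) s s' else 0) :> R.
Proof.
move=> pp pinj.
have p0 i : (0 < p i)%N by rewrite prime_gt0.
have p1 i : (1 < p i)%N by rewrite prime_gt1.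
pose g i n : R := (if i \in Q then psi (p i) s n else 1) * (if i \in Q' then psi (p i) s' n else 1).
pose P := (\prod_(i in Q :|: Q') p i)%N.
pose w : R := if Q == Q' then \prod_(i in Q) psi_corr (p i) s s' else 0.
have w0 : 0 <= w.
  rewrite /w; case: ifP => // _; apply: prodr_ge0 => i _.
  have : 0 <= (((p i)%:R - 1)^-1 : R) by rewrite invr_ge0 subr_ge0 ler1n.
  by rewrite /psi_corr; case: ifP => // _ h; rewrite exprn_ge0.
have hg i n : g i (n %% p i)%N = g i n by rewrite /g !psi_modr.
have eG n : (\prod_(i in Q) psi (p i) s n) * (\prod_(i in Q') psi (p i) s' n) =
    \prod_(i in Q :|: Q') g i n :> R.
  rewrite big_mkcond [X in _ * X]big_mkcond -big_split [RHS]big_mkcond /=.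
  apply: eq_bigr => i _; rewrite inE /g.
  by case: (i \in Q); case: (i \in Q'); rewrite /= ?mulr1.
rewrite (eq_bigr (fun n : 'I_N => \prod_(i in Q :|: Q') g i n)); last by move=> n _; exact: eG.
have PP : (0 < P)%N by apply: prodn_gt0.
have H := @periodic_sum_le R (fun n => \prod_(i in Q :|: Q') g i n) P w N PP w0.
apply: (@le_trans _ _ (P%:R + N%:R * w)); first apply: H.
- move=> n; rewrite normr_prod; apply: (@le_trans _ _ (\prod_(i in Q :|: Q') 1)); last by rewrite big1_eq.
  apply: ler_prod => i _; rewrite normr_ge0 /=.
  rewrite /g normrM; apply: mulr_ile1 => //; case: ifP; rewrite ?normr1 // => _; exact: psi_norm_le1.
- move=> n; apply: eq_bigr => i iQ; rewrite -hg -[in RHS]hg; congr (g i _).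
  by rewrite /P (bigD1 i) //= mulnC modnMDl.
- rewrite /P sum_prod_primes // normr_prod natr_prod /w.
  case: ifP => [/eqP e|ne].
    rewrite -e setUid -big_split /=; apply: ler_prod => i iQ; rewrite normr_ge0 /=.
    by rewrite /g -e iQ -(sum_psi_mul _ s s' (p1 i)) lexx.
  have [i] : exists i, (i \in Q) != (i \in Q').
    apply/existsP; rewrite -negb_forall; apply: contraFN ne => /forallP h.
    by apply/eqP/setP => i; apply/eqP.
  move=> hi; rewrite mulr0 (bigD1 i) /=; last by rewrite inE; case: (i \in Q) hi; case: (i \in Q').
  rewrite /g; case: (i \in Q) hi; case: (i \in Q') => // _.
    by under eq_bigr do rewrite mulr1; rewrite sum_psi // normr0 mul0r.
  by under eq_bigr do rewrite mul1r; rewrite sum_psi // normr0 mul0r.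
by rewrite lerD2r ler_nat leq_prod_setU.
Qed.


(** * The second moment of the oscillating part *)

Lemma sum_sqr_le (R : realDomainType) (U : finType) (a : U -> R) (phi : U -> nat -> R) (N : nat) :
  \sum_(n < N) (\sum_u a u * phi u n) ^+ 2 <=
  \sum_u \sum_v `|a u| * `|a v| * `|\sum_(n < N) phi u n * phi v n|.
Proof.
have -> : \sum_(n < N) (\sum_u a u * phi u n) ^+ 2 =
    \sum_u \sum_v a u * a v * \sum_(n < N) phi u n * phi v n.
  under eq_bigr do rewrite expr2 big_distrlr /=.
  rewrite exchange_big /=; apply: eq_bigr => u _.
  rewrite exchange_big /=; apply: eq_bigr => v _.
  by rewrite mulr_sumr; apply: eq_bigr => n _; ring.
apply: ler_sum => u _; apply: ler_sum => v _.
by apply: le_trans (ler_norm _) _; rewrite !normrM.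
Qed.

Lemma bernoulli_le (R : realDomainType) (q : R) (n : nat) : 0 <= q -> 1 + n%:R * q <= (1 + q) ^+ n.
Proof.
move=> q0; elim: n => [|n IH]; first by rewrite mul0r addr0 expr0.
rewrite exprS; apply: (@le_trans _ _ ((1 + q) * (1 + n%:R * q))).
  rewrite -natr1; have : 0 <= (n%:R : R) * q * q by rewrite !mulr_ge0.
  nra.
by rewrite ler_wpM2l // addr_ge0.
Qed.

Lemma prodr_1D_ge1 (R : realDomainType) (I : Type) (r : seq I) (w : I -> R) :
  (forall i, 0 <= w i) -> 1 <= \prod_(i <- r) (1 + w i).
Proof.
move=> w0; elim: r => [|i r IH]; rewrite ?big_nil ?big_cons //.
by rewrite mulr_ege1 // lerDl.
Qed.

Lemma sum_le_prodr_1D (R : realDomainType) (I : Type) (r : seq I) (w : I -> R) :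
  (forall i, 0 <= w i) -> \sum_(i <- r) w i <= \prod_(i <- r) (1 + w i).
Proof.
move=> w0; elim: r => [|i r IH]; first by rewrite !big_nil ler01.
rewrite !big_cons mulrDl mul1r addrC lerD // ler_peMr //.
exact: prodr_1D_ge1.
Qed.

(** Subtracting 1 removes the empty set from the expanded product; what remains keeps the factor
    [\sum w], where the saving [1 / z] will appear. *)
Lemma prodr_1D_sub1_le (R : realDomainType) (I : Type) (r : seq I) (w : I -> R) :
  (forall i, 0 <= w i) ->
  \prod_(i <- r) (1 + w i) - 1 <= (\sum_(i <- r) w i) * \prod_(i <- r) (1 + w i).
Proof.
move=> w0; elim: r => [|i r IH]; first by rewrite !big_nil mul0r subrr.
rewrite !big_cons.
have s0 : 0 <= \sum_(i <- r) w i by apply: sumr_ge0.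
have p1 := prodr_1D_ge1 r w0.
have wi := w0 i.
move: IH s0 p1; move: (\prod_(_ <- _) _) (\sum_(_ <- _) _) => P S IH s0 p1.
have : 0 <= w i * P * (w i + S) by rewrite !mulr_ge0 ?addr_ge0 //; lra.
nra.
Qed.

Lemma prod_primes_dvd (I : finType) (p : I -> nat) (m : nat) (K : {set I}) :
  (forall i, prime (p i)) -> injective p ->
  (forall i, i \in K -> (p i %| m)%N) -> (\prod_(i in K) p i %| m)%N.
Proof.
move=> pp pinj hK; rewrite -(big_enum _ _ (mem K)) /=.
have hK' i : i \in enum K -> (p i %| m)%N by rewrite mem_enum; apply: hK.
have := enum_uniq K; elim: (enum K) hK' => [|i r IH] hr; first by rewrite big_nil dvd1n.
rewrite /= => /andP[ir ur]; rewrite big_cons.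
have cop := coprime_prod_primes pp pinj ir.
rewrite Gauss_dvd // hr ?mem_head //= IH // => j jr.
by apply: hr; rewrite inE jr orbT.
Qed.

(** The product of these primes divides the nonzero difference, which is below [2 ^ k], and each
    prime is at least 2. *)
Lemma card_primes_eq_mod_le (I : finType) (p : I -> nat) (s s' k : nat) :
  (forall i, prime (p i)) -> injective p -> s != s' ->
  (s < 2 ^ k)%N -> (s' < 2 ^ k)%N ->
  (#|[set i | s == s' %[mod p i]]| <= k)%N.
Proof.
move=> pp pinj; wlog le_ss' : s s' / (s <= s')%N.
  move=> H; case: (leqP s s') => [h|/ltnW h] ne hs hs'; first exact: H.
  have -> : [set i | s == s' %[mod p i]] = [set i | s' == s %[mod p i]].
    by apply/setP => i; rewrite !inE eq_sym.
  by apply: H; rewrite // eq_sym.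
move=> ne hs hs'; set K := [set _ | _].
have d0 : (0 < s' - s)%N by rewrite subn_gt0 ltn_neqAle ne.
have hd : (\prod_(i in K) p i %| s' - s)%N.
  apply: prod_primes_dvd => // i; rewrite inE => h.
  by rewrite -eqn_mod_dvd // eq_sym.
have h2 : (2 ^ #|K| <= \prod_(i in K) p i)%N.
  by rewrite -prod_nat_const; apply: leq_prod => i _; rewrite prime_gt1.
rewrite -(@leq_exp2l 2) //; apply: leq_trans h2 _.
apply: leq_trans (dvdn_leq d0 hd) _.
by apply: leq_trans (leq_subr _ _) _; rewrite ltnW.
Qed.

(** The 9 is the product of the two factors [3 ^+ #|Q|] bounding the sieve coefficients, and
    [1 + 9 * q <= (1 + q) ^+ 9] turns it into [M ^+ 9]. For [s != s'] the sum of the correlations is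
    small: at most [k] primes divide [s - s'], each giving at most [1 / z], and the other primes
    give [q ^+ 2 <= q / z], where the sum of the [q] is at most [M]. *)
Lemma sum_psi_corr_prod_le (R : realFieldType) (I : finType) (p : I -> nat) (s s' k z : nat) (M : R) :
  M = \prod_i (1 + ((p i)%:R - 1)^-1) ->
  (forall i, prime (p i)) -> injective p -> (forall i, z < p i)%N -> (0 < z)%N ->
  (s < 2 ^ k)%N -> (s' < 2 ^ k)%N ->
  \sum_(Q : {set I} | Q != set0) \prod_(i in Q) (9 * psi_corr (p i) s s') <=
  M ^+ 9 * (if s == s' then 1 else 9 * (k%:R + M) / z%:R).
Proof.
move=> defM pp pinj zp z0 sk s'k.
pose q i : R := ((p i)%:R - 1)^-1.
have zR : (0 : R) < z%:R by rewrite ltr0n.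
have pz i : (z%:R : R) <= (p i)%:R - 1 by rewrite lerBrDr natr1 ler_nat.
have q0 i : 0 < q i by rewrite invr_gt0; apply: lt_le_trans (pz i).
have qz i : q i <= z%:R^-1 by rewrite /q lef_pV2 // posrE; apply: lt_le_trans (pz i).
have q1 i : q i <= 1.
  by apply: le_trans (qz i) _; rewrite invf_le1 // ler1n.
pose w i := 9 * psi_corr (p i) s s' : R.
have c0 i : 0 <= psi_corr (p i) s s' :> R.
  by rewrite /psi_corr -/(q i); case: ifP => _; rewrite ?sqr_ge0 // ltW.
have cq i : psi_corr (p i) s s' <= q i.
  rewrite /psi_corr -/(q i); case: ifP => _ //.
  by rewrite expr2 ler_piMr // ltW.
have w0 i : 0 <= w i by rewrite mulr_ge0.
have hP : \prod_i (1 + w i) <= M ^+ 9.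
  rewrite defM -prodrXl; apply: ler_prod => i _; rewrite addr_ge0 //=.
  apply: le_trans (bernoulli_le 9 (ltW (q0 i))).
  by rewrite lerD2l ler_wpM2l.
have -> : \sum_(Q : {set I} | Q != set0) \prod_(i in Q) (9 * psi_corr (p i) s s') =
    \prod_i (1 + w i) - 1.
  rewrite prodr_1D [in RHS](bigD1 set0) //= big_set0 addrAC subrr add0r.
  by apply: eq_bigl => Q; rewrite ?inE ?andbT.
case: eqP => [_|/eqP ne].
  by rewrite mulr1; apply: le_trans hP; rewrite gerBl.
apply: le_trans (prodr_1D_sub1_le _ w0) _.
rewrite mulrC; apply: ler_pM => //; first by apply: prodr_ge0 => i _; rewrite addr_ge0.
  by apply: sumr_ge0.
rewrite -mulr_sumr -mulrA ler_wpM2l // mulrDl.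
rewrite (bigID (fun i => s == s' %[mod p i])) /=; apply: lerD.
  apply: (@le_trans _ _ (\sum_(i | s == s' %[mod p i]) z%:R^-1)).
    by apply: ler_sum => i h; rewrite /psi_corr h; exact: qz.
  rewrite sumr_const -[leLHS]mulr_natl ler_wpM2r ?invr_ge0 // ler_nat.
  apply: leq_trans (card_primes_eq_mod_le pp pinj ne sk s'k).
  by rewrite cardsE.
apply: (@le_trans _ _ (\sum_i q i / z%:R)); last first.
  by rewrite -mulr_suml ler_wpM2r ?invr_ge0 // defM sum_le_prodr_1D // => i; exact: ltW.
rewrite big_mkcond; apply: ler_sum => i _; case: ifP => h; last first.
  by rewrite divr_ge0 // ltW.
by rewrite /psi_corr (negbTE h) expr2 -/(q i) ler_wpM2l // ltW.
Qed.


(** To sum over [Q] without counting sets, a factor [1 / (p - 1)] per prime is inserted through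
    [3 * p <= p ^ 4 / (p - 1)]: the fourth power of the product over [Q] is at most [y ^ 8] by
    [sieve_coef_neq0], and the inserted factors sum to [M]. *)
Lemma sum_sieve_coef_le (R : realFieldType) (I : finType) (p : I -> nat) (D : {set {set I}}) (y : nat) (M : R) :
  M = \prod_i (1 + ((p i)%:R - 1)^-1) ->
  (forall i, prime (p i)) ->
  (forall K, K \in D -> (\prod_(i in K) p i <= y)%N) ->
  \sum_Q `|sieve_coef p D Q| * (\prod_(i in Q) p i)%:R <= M ^+ 2 * y%:R ^+ 8 :> R.
Proof.
move=> defM pp hD.
pose q i : R := ((p i)%:R - 1)^-1.
have p2 i : (2 : R) <= (p i)%:R by rewrite ler_nat prime_gt1.
have q0 i : 0 < q i by rewrite invr_gt0; have := p2 i; lra.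
have M0 : 0 <= M by rewrite defM; apply: prodr_ge0 => i _; rewrite addr_ge0 //; exact: ltW (q0 i).
apply: (@le_trans _ _ (\sum_(Q : {set I}) M * y%:R ^+ 8 * \prod_(i in Q) q i)); last first.
  by rewrite -mulr_sumr -prodr_1D -defM mulrAC expr2.
apply: ler_sum => Q _.
have pq0 : 0 <= \prod_(i in Q) q i by apply: prodr_ge0 => i _; rewrite ltW.
have [->|cn0] := eqVneq (sieve_coef p D Q : R) 0.
  by rewrite normr0 mul0r !mulr_ge0 ?exprn_ge0.
have nQ := sieve_coef_neq0 pp hD cn0.
apply: le_trans (ler_wpM2r _ (sieve_coef_le R D Q pp)) _; first exact: ler0n.
rewrite -defM mulrAC mulrC -mulrA ler_wpM2l //.
apply: (@le_trans _ _ ((\prod_(i in Q) p i)%:R ^+ 4 * \prod_(i in Q) q i)).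
  rewrite -prodr_const natr_prod -prodrXl -!big_split /=.
  apply: ler_prod => i _; rewrite mulr_ge0 //= /q ler_pdivlMr; last by have := p2 i; lra.
  have := p2 i; move: ((p i)%:R) => x x2.
  have : 0 <= x * x * (x * x - 3) by rewrite mulr_ge0 //; nra.
  rewrite !exprS expr0; nra.
rewrite ler_wpM2r // -natrX -natrX ler_nat.
by have := leq_exp2r (\prod_(i in Q) p i) (y ^ 2) (e := 4) isT; rewrite nQ -expnM.
Qed.

(** The square is expanded over pairs [(t, Q)]. The errors from incomplete periods form the square
    of a single sum, bounded by [sum_sieve_coef_le]. The main terms have [Q = Q']; two sieve
    coefficients give [M ^+ 2] and the correlations [M ^+ 9]. *)
Lemma dispersion_le (R : realFieldType) (I T : finType) (p : I -> nat) (sigma : T -> nat)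
    (D : {set {set I}}) (y z k N : nat) (M : R) :
  M = \prod_i (1 + ((p i)%:R - 1)^-1) ->
  (forall i, prime (p i)) -> injective p -> (forall i, z < p i)%N -> (0 < z)%N ->
  (forall K, K \in D -> (\prod_(i in K) p i <= y)%N) ->
  injective sigma -> (forall t, sigma t < 2 ^ k)%N ->
  \sum_(n < N) (\sum_t \sum_(Q : {set I} | Q != set0)
      sieve_coef p D Q * \prod_(i in Q) psi (p i) (sigma t) n) ^+ 2 <=
  #|T|%:R ^+ 2 * (M ^+ 4 * y%:R ^+ 16) +
  N%:R * (M ^+ 11 * (#|T|%:R + #|T|%:R ^+ 2 * (9 * (k%:R + M) / z%:R))).
Proof.
move=> defM pp pinj zp z0 hD sinj sk.
have M0 : 0 <= M.
  rewrite defM; apply: prodr_ge0 => i _; rewrite addr_ge0 // invr_ge0 subr_ge0 ler1n.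
  exact: prime_gt0.
pose a (u : T * {set I}) : R := if u.2 != set0 then sieve_coef p D u.2 else 0.
pose phi (u : T * {set I}) n : R := \prod_(i in u.2) psi (p i) (sigma u.1) n.
rewrite (eq_bigr (fun n : 'I_N => (\sum_u a u * phi u n) ^+ 2)); last first.
  move=> n _; congr (_ ^+ 2); rewrite -(pair_bigA _ (fun t Q => a (t, Q) * phi (t, Q) n)) /=.
  apply: eq_bigr => t _; rewrite big_mkcond; apply: eq_bigr => Q _.
  by rewrite /a /phi /=; case: ifP => _; rewrite ?mul0r.
apply: le_trans (sum_sqr_le _ _ _) _.
pose nn (u : T * {set I}) : R := (\prod_(i in u.2) p i)%:R.
pose W (u v : T * {set I}) : R :=
  if u.2 == v.2 then \prod_(i in u.2) psi_corr (p i) (sigma u.1) (sigma v.1) else 0.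
have corr0 i s s' : 0 <= psi_corr (p i) s s' :> R.
  rewrite /psi_corr; case: ifP => _; rewrite ?sqr_ge0 // invr_ge0 subr_ge0 ler1n.
  exact: prime_gt0.
apply: (@le_trans _ _ (\sum_u \sum_v (`|a u| * nn u) * (`|a v| * nn v) +
    N%:R * \sum_u \sum_v `|a u| * `|a v| * W u v)).
  rewrite mulr_sumr -big_split; apply: ler_sum => u _ /=.
  rewrite mulr_sumr -big_split; apply: ler_sum => v _ /=.
  have -> : `|a u| * nn u * (`|a v| * nn v) + N%:R * (`|a u| * `|a v| * W u v) =
     `|a u| * `|a v| * (nn u * nn v + N%:R * W u v) by ring.
  rewrite ler_wpM2l ?mulr_ge0 // /nn -natrM.
  exact: sum_psi_prod_le.
apply: lerD.
  rewrite -big_distrlr /= -expr2.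
  have h : \sum_u `|a u| * nn u <= #|T|%:R * (M ^+ 2 * y%:R ^+ 8).
    rewrite -(pair_bigA _ (fun t Q => `|a (t, Q)| * nn (t, Q))) /=.
    rewrite mulr_natl -sumr_const; apply: ler_sum => t _.
    apply: le_trans (sum_sieve_coef_le defM pp hD); apply: ler_sum => Q _.
    rewrite /a /nn /=; case: ifP => _ //.
    by rewrite normr0 mul0r mulr_ge0.
  apply: (@le_trans _ _ ((#|T|%:R * (M ^+ 2 * y%:R ^+ 8)) ^+ 2)).
    rewrite ler_sqr // ?nnegrE; first by apply: sumr_ge0 => u _; rewrite mulr_ge0.
    by rewrite !mulr_ge0 ?exprn_ge0.
  by rewrite le_eqVlt; apply/orP; left; apply/eqP; ring.
rewrite ler_wpM2l //.
set q := 9 * _ / _.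
have q0 : 0 <= q by rewrite divr_ge0 // mulr_ge0 // addr_ge0.
apply: (@le_trans _ _ (\sum_t \sum_t' M ^+ 2 * \sum_(Q : {set I} | Q != set0)
    \prod_(i in Q) (9 * psi_corr (p i) (sigma t) (sigma t')))).
  rewrite -(pair_bigA _ (fun t Q => \sum_v `|a (t, Q)| * `|a v| * W (t, Q) v)) /=.
  apply: ler_sum => t _.
  under eq_bigr => Q _ do rewrite -(pair_bigA _ (fun t' Q' => `|a (t, Q)| * `|a (t', Q')| * W (t, Q) (t', Q'))) /=.
  rewrite exchange_big /=; apply: ler_sum => t' _.
  rewrite mulr_sumr [leRHS]big_mkcond; apply: ler_sum => Q _.
  rewrite (bigD1 Q) //= [X in _ + X]big1 ?addr0; last first.
    by move=> Q' ne; rewrite /W /= eq_sym (negbTE ne) mulr0.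
  rewrite /a /W /= eqxx; case: ifP => _; last by rewrite normr0 !mul0r.
  rewrite big_split /= mulrA prodr_const.
  rewrite ler_wpM2r //; first by apply: prodr_ge0.
  have h := sieve_coef_le R D Q pp; rewrite -defM in h.
  have -> : M ^+ 2 * 9 ^+ #|Q| = (3 ^+ #|Q| * M) * (3 ^+ #|Q| * M).
    by rewrite (_ : 9 = 3 * 3) ?exprMn; [ring|ring].
  by apply: ler_pM.
apply: (@le_trans _ _ (\sum_t \sum_t' M ^+ 11 * (if t == t' then 1 else q))).
  apply: ler_sum => t _; apply: ler_sum => t' _.
  have -> : M ^+ 11 = M ^+ 2 * M ^+ 9 by rewrite -exprD.
  rewrite -[leRHS]mulrA ler_wpM2l ?exprn_ge0 //.
  apply: le_trans (sum_psi_corr_prod_le defM pp pinj zp z0 (sk t) (sk t')) _.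
  by rewrite (inj_eq sinj).
under eq_bigr do rewrite -mulr_sumr.
rewrite -mulr_sumr ler_wpM2l ?exprn_ge0 //.
apply: (@le_trans _ _ (\sum_(t : T) (1 + #|T|%:R * q))).
  apply: ler_sum => t _; rewrite (bigD1 t) //= eqxx lerD2l.
  rewrite mulr_natl -sumr_const [leLHS]big_mkcond.
  by apply: ler_sum => t' _; rewrite [t == t']eq_sym; case: eqP.
by rewrite sumr_const -[leLHS]mulr_natl mulrDr mulr1 mulrA expr2.
Qed.


(** * The dichotomy: a large sumset, or few primes *)

Lemma sqr_sum_le (R : realDomainType) (I : finType) (x : I -> R) :
  (\sum_i x i) ^+ 2 <= #|I|%:R * \sum_i x i ^+ 2.
Proof.
have h : 0 <= \sum_i \sum_j (x i - x j) ^+ 2.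
  by apply: sumr_ge0 => i _; apply: sumr_ge0 => j _; apply: sqr_ge0.
have e : \sum_i \sum_j (x i - x j) ^+ 2 =
   (#|I|%:R * \sum_i x i ^+ 2 - (\sum_i x i) ^+ 2) *+ 2.
  transitivity (\sum_i (#|I|%:R * x i ^+ 2 - (\sum_j x i * x j) *+ 2 + \sum_j x j ^+ 2)).
    apply: eq_bigr => i _.
    rewrite [#|I|%:R * _]mulr_natl -sumr_const -sumrMnl -sumrN -!big_split /=.
    by apply: eq_bigr => j _; ring.
  rewrite !big_split /= sumrN sumrMnl sumr_const -mulr_sumr expr2 big_distrlr /=.
  by rewrite -[X in _ + X = _]mulr_natl; ring.
by move: h; rewrite e pmulrn_lge0 // subr_ge0.
Qed.

Lemma sumset_large_or_few (R : realFieldType) (I : finType) (p : I -> nat)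
    (D : {set {set I}}) (y z k N : nat) (M L : R) (A : {fset nat}) :
  M = \prod_i (1 + ((p i)%:R - 1)^-1) ->
  L = \sum_(K in D) \prod_(i in K) ((p i)%:R - 1)^-1 -> 1 <= L ->
  (forall i, prime (p i)) -> injective p -> (forall i, z < p i)%N -> (0 < z)%N ->
  (forall i, p i <= y)%N ->
  (forall K, K \in D -> (\prod_(i in K) p i <= y)%N) ->
  (forall a, a \in A -> prime a) -> (forall a, a \in A -> (a < N)%N) ->
  (2 * N <= 2 ^ k)%N ->
  let s : R := #|` sumset A A|%:R in
  let a : R := #|` A|%:R in
  let a' : R := #|` [fset q in A | (y < q)%N]|%:R in
  a' * L <= 2 * s \/
  a * a' <= 4 * (a' * (M ^+ 4 * y%:R ^+ 16) +
     N%:R * (M ^+ 11 * (1 + a' * (9 * (k%:R + M) / z%:R)))).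
Proof.
move=> defM defL L1 pp pinj zp z0 py hD primeA AN Nk s a a'.
set A' := [fset q in A | (y < q)%N] in a' *.
set q := 9 * _ / _.
pose S := sumset A A.
have inS u v : u \in A -> v \in A -> (u + v)%N \in S.
  by move=> hu hv; rewrite /S /sumset in_imfset2.
have A'A (v : A') : val v \in A by have := valP v; rewrite !inE => /andP[].
have A'y (v : A') : (y < val v)%N by have := valP v; rewrite !inE => /andP[].
have M0 : 0 <= M.
  rewrite defM; apply: prodr_ge0 => i _; rewrite addr_ge0 // invr_ge0 subr_ge0 ler1n.
  exact: prime_gt0.
have L0 : 0 < L by lra.
have q0 : 0 <= q by rewrite divr_ge0 // mulr_ge0 // addr_ge0.
pose h (t n : nat) : R := \sum_(K in D) \prod_(i in K) psi (p i) t n.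
pose F (n : nat) : R := \sum_(t : S) \sum_(Q : {set I} | Q != set0)
      sieve_coef p D Q * \prod_(i in Q) psi (p i) (val t) n.
have hh t n : h t n ^+ 2 = L + \sum_(Q : {set I} | Q != set0)
      sieve_coef p D Q * \prod_(i in Q) psi (p i) t n.
  by rewrite sieve_sqrE // (bigD1 set0) //= big_set0 mulr1 sieve_coef0 -defL.
(* The difference of the arguments is the prime [v > y], divisible by no [p i <= y], so every [psi]
   takes its positive value. *)
have hL (u : A) (v : A') : h (val u + val v)%N (val u) = L.
  rewrite /h defL; apply: eq_bigr => K _; apply: eq_bigr => i _.
  rewrite /psi; case: ifP => //; rewrite -{2}[val u]addn0 eqn_modDl mod0n.
  rewrite -/(p i %| val v)%N dvdn_prime2 //; last exact: primeA.
  by move=> /eqP e; have := A'y v; rewrite -e ltnNge py.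
have lower : a * (a' * L ^+ 2) <= \sum_(u : A) \sum_(t : S) h (val t) (val u) ^+ 2.
  rewrite /a cardfE mulr_natl -sumr_const; apply: ler_sum => u _.
  pose f (v : A') : S := [` inS (val u) (val v) (valP u) (A'A v)].
  have finj : injective f.
    by move=> v w /(congr1 val) /= /addnI e; apply: val_inj.
  rewrite /a' cardfE mulr_natl -sumr_const.
  apply: le_trans (ler_sum_inj (f := f) (F := fun t : S => h (val t) (val u) ^+ 2) finj _).
    by apply: ler_sum => v _; rewrite /= hL.
  by move=> t; exact: sqr_ge0.
pose X := \sum_(u : A) F (val u).
have upper : \sum_(u : A) \sum_(t : S) h (val t) (val u) ^+ 2 = a * (s * L) + X.
  rewrite /a cardfE mulr_natl -sumr_const -big_split; apply: eq_bigr => u _ /=.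
  under eq_bigr do rewrite hh.
  by rewrite big_split /= sumr_const -cardfE -[X in X + _]mulr_natl.
pose V := s ^+ 2 * (M ^+ 4 * y%:R ^+ 16) + N%:R * (M ^+ 11 * (s + s ^+ 2 * q)).
have XV : X ^+ 2 <= a * V.
  apply: le_trans (sqr_sum_le _) _; rewrite -cardfE ler_wpM2l //.
  have Sk (t : S) : (val t < 2 ^ k)%N.
    have := valP t; rewrite /S /sumset => /imfset2P[u uA [v vA ->]].
    by apply: leq_trans Nk; have := AN _ uA; have := AN _ vA; lia.
  have := dispersion_le N defM pp pinj zp z0 hD (@val_inj _ _ S) Sk.
  rewrite -cardfE; apply: le_trans.
  pose g (u : A) : 'I_N := Ordinal (AN _ (valP u)).
  have ginj : injective g by move=> u v /(congr1 val) /= e; apply: val_inj.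
  apply: le_trans (ler_sum_inj (f := g) (F := fun n : 'I_N => F n ^+ 2) ginj _) => //.
  by move=> n; exact: sqr_ge0.
case: (lerP (a' * L) (2 * s)) => hs; [by left|right].
have s0 : 0 <= s by apply: ler0n.
have a0 : 0 <= a by apply: ler0n.
have a'0 : 0 < a'.
  by rewrite -(pmulr_lgt0 _ L0); apply: le_lt_trans hs; rewrite mulr_ge0.
have [->|an0] := eqVneq a 0.
  rewrite mul0r; apply: mulr_ge0 => //; apply: addr_ge0.
    by rewrite !mulr_ge0 ?exprn_ge0 // ltW.
  have h1 : 0 <= 1 + a' * q by rewrite addr_ge0 // mulr_ge0 // ltW.
  by rewrite mulr_ge0 // mulr_ge0 // exprn_ge0.
have {an0 a0} a0 : 0 < a by rewrite lt0r an0.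
rewrite upper in lower.
have hX : a * (a' * L ^+ 2) <= 2 * X.
  have : a * (s * L) * 2 <= a * (a' * L ^+ 2).
    rewrite -mulrA ler_pM2l // expr2 mulrAC mulrA ler_pM2r // mulrC; exact: ltW.
  lra.
have hX2 : (a * (a' * L ^+ 2)) ^+ 2 <= 4 * (a * V).
  apply: (@le_trans _ _ ((2 * X) ^+ 2)).
    have h0 : 0 <= a * (a' * L ^+ 2) by rewrite !mulr_ge0 ?exprn_ge0 ?ltW.
    by rewrite ler_sqr // nnegrE // (le_trans h0).
  by rewrite exprMn (_ : 2 ^+ 2 = 4 :> R) ?ler_pM2l //; ring.
have sL : s <= a' * L by lra.
(* The failure of the first alternative bounds [s] by [a' * L]. Since [L >= 1], a common factor
   [L ^+ 4 * a'] comes out of [V] and cancels against the left side, leaving an inequality free of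
   [s] and [L]. *)
pose G := a' * (M ^+ 4 * y%:R ^+ 16) + N%:R * (M ^+ 11 * (1 + a' * q)).
have VG : V <= L ^+ 4 * a' * G.
  have L2 : s ^+ 2 <= L ^+ 4 * a' ^+ 2.
    apply: (@le_trans _ _ ((a' * L) ^+ 2)); first by rewrite ler_sqr // nnegrE // mulr_ge0 // ltW.
    rewrite exprMn mulrC ler_wpM2r ?sqr_ge0 //.
    by rewrite ler_weXn2l.
  have L3 : s <= L ^+ 4 * a'.
    apply: le_trans sL _; rewrite mulrC ler_pM2r // -[leLHS]expr1.
    by rewrite ler_weXn2l.
  have -> : L ^+ 4 * a' * G = L ^+ 4 * a' ^+ 2 * (M ^+ 4 * y%:R ^+ 16) +
     N%:R * (M ^+ 11 * (L ^+ 4 * a' + L ^+ 4 * a' ^+ 2 * q)).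
    by rewrite /G; ring.
  rewrite /V lerD // ?ler_wpM2r // ?mulr_ge0 ?exprn_ge0 //.
  rewrite ler_wpM2l // ler_wpM2l ?exprn_ge0 //.
  by rewrite lerD // ler_wpM2r.
rewrite -/G.
have e1 : (a * (a' * L ^+ 2)) ^+ 2 = (a * a') * (a * (L ^+ 4 * a')) by ring.
have e2 : 4 * (a * (L ^+ 4 * a' * G)) = (4 * G) * (a * (L ^+ 4 * a')) by ring.
have c0 : 0 < a * (L ^+ 4 * a') by rewrite !mulr_gt0 ?exprn_gt0.
rewrite -(ler_pM2r c0) -e1 -e2; apply: le_trans hX2 _.
by rewrite ler_pM2l // ler_pM2l.
Qed.


(** * Numerical estimates and the choice of parameters *)

Lemma prod_primes_in_le (R : realType) (z y : nat) : (1 < y)%N ->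
  \prod_(i : primes_in z y) (1 + ((val (val i))%:R - 1)^-1 : R) <=
  2 * expR 2 * (1 + ln y%:R).
Proof.
move=> y1; apply: le_trans (mertens_prod_le R y1).
rewrite -(big_sub [pred i : 'I_y.+1 | prime i && (z < i)%N]
  (fun i : 'I_y.+1 => 1 + (i%:R - 1)^-1 : R)).
rewrite big_mkcond [leRHS]big_mkcond; apply: ler_prod => i _.
have hp : prime i -> (i%:R : R) / (i%:R - 1) = 1 + (i%:R - 1)^-1.
  move=> pi; have : (2 : R) <= i%:R by rewrite ler_nat prime_gt1.
  by move=> h; field; apply: lt0r_neq0; lra.
have hq : prime i -> 0 <= ((i%:R : R) - 1)^-1.
  by move=> pi; rewrite invr_ge0 subr_ge0 ler1n prime_gt0.
rewrite inE /=; case pi: (prime i) => /=; last by rewrite lexx ler01.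
by case: ifP => _; rewrite hp // ?lexx ?ler01 ?lerDl ?addr_ge0 ?hq.
Qed.

Lemma expR_ge_poly (R : realType) (K d : R) (m : nat) : 0 < d ->
  exists l0 : R, forall l, l0 <= l -> K * l ^+ m <= expR (l / d).
Proof.
move=> d0; pose c : R := d ^+ m.+1 * (m.+1)`!%:R.
have c0 : 0 < c by rewrite mulr_gt0 ?exprn_gt0 // ltr0n fact_gt0.
exists (1 + `|K| * c) => l hl.
have l0 : 0 < l by apply: lt_le_trans hl; rewrite ltr_wpDr // mulr_ge0 // ltW.
have := @expR_ge1Dxn R (l / d) m; rewrite divr_ge0 ?(ltW l0) ?(ltW d0) // => /(_ isT) h.
apply: le_trans h; rewrite ler_wpDl //.
rewrite exprMn exprVn -mulrA -invfM -/c ler_pdivlMr // exprS.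
rewrite mulrAC ler_pM2r ?exprn_gt0 //.
apply: le_trans hl; apply: ler_wpDl => //.
by rewrite ler_wpM2r ?(ltW c0) // ler_norm.
Qed.

Lemma ln_ge_of_expR_le (R : realType) (b l : R) : expR b <= l -> b <= ln l.
Proof.
move=> h; rewrite -[b]expRK ler_ln // posrE ?expR_gt0 //.
exact: lt_le_trans (expR_gt0 _) h.
Qed.

Lemma expR_le_4X (R : realType) (l : R) (w : nat) : l <= w%:R -> expR l <= 4 ^+ w.
Proof.
move=> lw; apply: (@le_trans _ _ (expR w%:R)); first by rewrite ler_expR.
have -> : (w%:R : R) = (2 * w)%:R * 2^-1 by rewrite natrM; field.
have h2 : expR (2^-1) <= 2 :> R.
  have h : 2^-1 <= expR (- 2^-1) :> R by apply: le_trans (expR_ge1Dx _); lra.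
  by move: h; rewrite expRN lef_pV2 // posrE ?expR_gt0.
have -> : (4 : R) = 2 ^+ 2 by ring.
rewrite -exprM expRM_natl.
by rewrite lerXn2r // nnegrE ?expR_ge0.
Qed.

(** Excludes the second alternative, with [l = ln x] and [E] the 48th root of [x]: after division by
    [a'] and multiplication by [T = l ^+ e.+1], each of the three terms on the right is at most
    [x / 4], whereas [T * a >= x]. *)
Lemma few_contradiction (R : realFieldType) (e : nat) (C l E x a a' M Y N k z : R) :
  1 <= l -> 1 <= C -> x = E ^+ 48 -> 4 <= E ->
  (4 * C ^+ 4 + 16 * C ^+ 11) * l ^+ (2 * e + 14) <= E ->
  288 * C ^+ 11 * (6 + C) <= l ->
  x <= a * l ^+ e.+1 -> a <= 2 * a' -> 0 <= M <= C * l ->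
  0 <= Y <= E -> 0 <= N <= 2 * x -> 0 <= k <= 6 * l -> l ^+ (e + 14) <= z ->
  a * a' <= 4 * (a' * (M ^+ 4 * Y ^+ 16) + N * (M ^+ 11 * (1 + a' * (9 * (k + M) / z)))) ->
  False.
Proof.
have n1 : (e.+1 + 4 <= 2 * e + 14)%N by lia.
have n2 : (e.+1 + e.+1 + 11 <= 2 * e + 14)%N by lia.
move=> l1 C1 xE E4 hE hl ha ha' /andP[M0 MC] /andP[Y0 YE] /andP[N0 Nx] /andP[k0 kl] hz H.
have l0 : 0 < l by lra.
have C0 : 0 < C by lra.
have E0 : 0 < E by lra.
have E1 : 1 <= E by lra.
have x0 : 0 < x by rewrite xE exprn_gt0.
pose T := l ^+ e.+1.
have T0 : 0 < T by rewrite exprn_gt0.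
have a0 : 0 < a by rewrite -(pmulr_lgt0 _ T0); apply: lt_le_trans ha.
have a'0 : 0 < a' by lra.
have z0 : 0 < z by apply: lt_le_trans hz; rewrite exprn_gt0.
(* From [x <= a * T <= 2 * a' * T] one gets [1 <= a' * r], so the lone [1] also becomes a multiple
   of [a']. *)
pose r := 2 * T / x; pose q := 9 * (k + M) / z.
have r0 : 0 < r by rewrite divr_gt0 // mulr_gt0.
have q0 : 0 <= q by rewrite divr_ge0 ?(ltW z0) // mulr_ge0 // addr_ge0.
have hr : 1 <= a' * r.
  rewrite /r mulrA ler_pdivlMr // mul1r; apply: le_trans ha _.
  by rewrite -/T mulrA ler_pM2r // mulrC.
have B0 : 0 <= M ^+ 11 by rewrite exprn_ge0.
have h1 : a <= 4 * (M ^+ 4 * Y ^+ 16 + N * (M ^+ 11 * (r + q))).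
  rewrite -(ler_pM2r a'0); apply: le_trans H _.
  have -> : 4 * (M ^+ 4 * Y ^+ 16 + N * (M ^+ 11 * (r + q))) * a' =
    4 * (a' * (M ^+ 4 * Y ^+ 16) + N * (M ^+ 11 * (a' * r + a' * q))) by ring.
  by rewrite ler_pM2l // lerD2l ler_wpM2l // ler_wpM2l // lerD2r.
have MC4 : M ^+ 4 <= C ^+ 4 * l ^+ 4 by rewrite -exprMn lerXn2r // nnegrE // mulr_ge0 // ltW.
have MC11 : M ^+ 11 <= C ^+ 11 * l ^+ 11 by rewrite -exprMn lerXn2r // nnegrE // mulr_ge0 // ltW.
have YE16 : Y ^+ 16 <= E ^+ 16 by rewrite lerXn2r // nnegrE // ltW.
have lpow (i j : nat) : (i <= j)%N -> l ^+ i <= l ^+ j by move=> ij; rewrite ler_weXn2l.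
have c4 : 0 < C ^+ 4 by rewrite exprn_gt0.
have c11 : 0 < C ^+ 11 by rewrite exprn_gt0.
have lm0 : 0 < l ^+ (2 * e + 14) by rewrite exprn_gt0.
have t1 : T * (4 * (M ^+ 4 * Y ^+ 16)) <= x / 4.
  apply: (@le_trans _ _ (E * E ^+ 16)).
    have -> : T * (4 * (M ^+ 4 * Y ^+ 16)) = T * 4 * M ^+ 4 * Y ^+ 16 by ring.
    have g1 : 0 <= T * 4 * M ^+ 4 by rewrite mulr_ge0 ?exprn_ge0 // mulr_ge0 // ltW.
    have g2 : 0 <= Y ^+ 16 by rewrite exprn_ge0.
    apply: ler_pM => //.
    apply: le_trans hE.
    apply: (@le_trans _ _ (4 * C ^+ 4 * l ^+ (2 * e + 14))); last first.
      by rewrite ler_pM2r // lerDl mulr_ge0 // ltW.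
    apply: (@le_trans _ _ (T * 4 * (C ^+ 4 * l ^+ 4))).
      by rewrite ler_pM2l // mulr_gt0.
    have -> : T * 4 * (C ^+ 4 * l ^+ 4) = 4 * C ^+ 4 * l ^+ (e.+1 + 4) by rewrite exprD /T; ring.
    by apply: ler_wpM2l; [rewrite mulr_ge0 // ltW|exact: lpow].
  have -> : E * E ^+ 16 = E ^+ 17 by rewrite -exprS.
  rewrite ler_pdivlMr // xE (_ : E ^+ 48 = E ^+ 17 * E ^+ 31); last by rewrite -exprD.
  rewrite ler_pM2l ?exprn_gt0 //; apply: le_trans E4 _.
  by rewrite ler_eXnr.
have t2 : T * (4 * (N * (M ^+ 11 * r))) <= x / 4.
  apply: (@le_trans _ _ E); last first.
    rewrite ler_pdivlMr // xE (_ : E ^+ 48 = E * E ^+ 47); last by rewrite -exprS.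
    rewrite ler_pM2l //; apply: le_trans E4 _.
    by rewrite ler_eXnr.
  apply: (@le_trans _ _ (T * (4 * (2 * x * (C ^+ 11 * l ^+ 11 * r))))).
    rewrite ler_pM2l // ler_pM2l //; apply: ler_pM => //; first by rewrite mulr_ge0 // ltW.
    by rewrite ler_pM2r.
  have -> : T * (4 * (2 * x * (C ^+ 11 * l ^+ 11 * r))) = 16 * C ^+ 11 * (T * T * l ^+ 11).
    by rewrite /r; field; rewrite gt_eqF.
  have -> : T * T * l ^+ 11 = l ^+ (e.+1 + e.+1 + 11) by rewrite !exprD.
  apply: le_trans hE; apply: (@le_trans _ _ (16 * C ^+ 11 * l ^+ (2 * e + 14))).
    by apply: ler_wpM2l; [rewrite mulr_ge0 // ltW|exact: lpow].
  by rewrite ler_pM2r // lerDr mulr_ge0 // ltW.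
have t3 : T * (4 * (N * (M ^+ 11 * q))) <= x / 4.
  (* The exponent [e + 14] is one more than [e.+1] (from [T]) plus 11 (from [M ^+ 11]) plus 1 (from
     [k + M]); the spare factor [1 / l] absorbs the constants. *)
  have hq : q <= 9 * (6 + C) * l / l ^+ (e + 14).
    rewrite /q; apply: ler_pM => //; rewrite ?invr_ge0 ?mulr_ge0 ?addr_ge0 ?(ltW z0) //.
      by rewrite -mulrA ler_pM2l // mulrDl lerD.
    by rewrite lef_pV2 ?posrE // exprn_gt0.
  apply: (@le_trans _ _ (T * (4 * (2 * x * (C ^+ 11 * l ^+ 11 * (9 * (6 + C) * l / l ^+ (e + 14))))))).
    rewrite ler_pM2l // ler_pM2l //; apply: ler_pM => //; first by rewrite mulr_ge0.
    by apply: ler_pM.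
  have -> : T * (4 * (2 * x * (C ^+ 11 * l ^+ 11 * (9 * (6 + C) * l / l ^+ (e + 14))))) =
      x / 4 * (288 * C ^+ 11 * (6 + C)) / l.
    rewrite /T (exprS l e) exprD.
    have le0 : l ^+ e != 0 by rewrite gt_eqF // exprn_gt0.
    by field; rewrite le0 gt_eqF.
  by rewrite ler_pdivrMr // ler_pM2l // divr_gt0.
have : T * a <= x / 4 + x / 4 + x / 4.
  have := h1; rewrite -(ler_pM2l T0) => h; apply: le_trans h _.
  have -> : T * (4 * (M ^+ 4 * Y ^+ 16 + N * (M ^+ 11 * (r + q)))) =
     T * (4 * (M ^+ 4 * Y ^+ 16)) + T * (4 * (N * (M ^+ 11 * r))) + T * (4 * (N * (M ^+ 11 * q))) by ring.
  by rewrite lerD // lerD.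
move: ha; rewrite -/T mulrC; lra.
Qed.

Lemma cardfs_le_above (A : {fset nat}) (y : nat) :
  (#|` A| <= #|` [fset q in A | (y < q)%N]| + y.+1)%N.
Proof.
have sA : A `<=` [fset q in A | (y < q)%N] `|` [fset q in iota 0 y.+1].
  apply/fsubsetP => q qA; rewrite !inE qA /= mem_iota /=.
  lia.
apply: leq_trans (fsubset_leq_card sA) _.
rewrite cardfsU; apply: leq_trans (leq_subr _ _) _; rewrite leq_add2l.
by rewrite card_fseq (leq_trans (size_undup _)) // size_iota.
Qed.

Lemma powRN_ge (R : realType) (l c : R) (e : nat) : 1 <= l -> c <= e%:R ->
  (l ^+ e)^-1 <= l `^ (- c).
Proof.
move=> l1 ce; have l0 : 0 < l by apply: lt_le_trans l1.
rewrite powRN lef_pV2 ?posrE ?exprn_gt0 ?powR_gt0 //.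
by rewrite -powR_mulrn ?(ltW l0) // ler_powR.
Qed.

Unset Implicit Arguments.

Theorem theorem1p1 (R : realType) (c0 : R) (hc0 : 0 < c0) :
  exists x0 c : R, [/\ 0 < x0, 0 < c &
    forall (x : R), x0 <= x ->
    forall (A : {fset nat}) (delta : R),
      (forall p : nat, p \in A -> prime p /\ 1 <= (p%:R : R) <= x) ->
      #|` A|%:R = delta * x * (ln x)^-1 ->
      (ln x) `^ (- c0) <= delta ->
      c * delta * x * (ln (ln x))^-1 <= #|` sumset A A|%:R].
Proof.
pose e := (Num.trunc c0).+1; pose em := (e + 14)%N.
have n1 : (em <= 2 * e + 14)%N by rewrite /em; lia.
have n2 : (e.+1 <= 2 * e + 14)%N by lia.
(* The existential makes the constant opaque; its value is available only through the equation. *)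
have [C1 defC1] : exists C1 : R, C1 = 2 * expR 2 by exists (2 * expR 2).
have [C defC] : exists C : R, C = 2 * C1 by exists (2 * C1).
have C11 : 1 <= C1.
  have := expR_ge1Dx (2 : R); rewrite defC1; lra.
have C0 : 1 <= C by rewrite defC; lra.
have [K1 defK1] : exists K1 : R, K1 = 4 * C ^+ 4 + 16 * C ^+ 11.
  by exists (4 * C ^+ 4 + 16 * C ^+ 11).
(* The three summands serve [few_contradiction], [z <= y] and [4 * E <= a] respectively. *)
have [K defK] : exists K : R, K = K1 + 2 ^+ em + 4 by exists (K1 + 2 ^+ em + 4).
have [KC defKC] : exists KC : R, KC = 288 * C ^+ 11 * (6 + C).
  by exists (288 * C ^+ 11 * (6 + C)).
have K10 : 0 <= K1 by rewrite defK1 addr_ge0 // mulr_ge0 // exprn_ge0 //; lra.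
have K20 : (0 : R) <= 2 ^+ em by rewrite exprn_ge0.
(* [K2] is the constant in [l <= K2 * ln l * L]: 48 from [y] near [x ^ (1 / 48)], [C1] from
   [mertens_prod_le], and [2 * em + 1] from [1 + ln z]. *)
have [K2 defK2] : exists K2 : R, K2 = 48 * (C1 * (2 * em%:R + 1)).
  by exists (48 * (C1 * (2 * em%:R + 1))).
have K2p : 0 < K2.
  have h : (0 : R) < 2 * em%:R + 1 by rewrite ltr_wpDl // mulr_ge0.
  by rewrite defK2 mulr_gt0 // mulr_gt0 //; lra.
have [la hla] := expR_ge_poly K (2 * e + 14) (d := 48 : R) (ltr0Sn R 47).
have [lb hlb] := expR_ge_poly K2 1 (d := 1 : R) ltr01.
(* A sum of nonnegative thresholds for [ln x]; the exponentials make [ln (ln x)] at least [lb] and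
   at least 1. *)
pose l0 := `|la| + expR `|lb| + expR 1 + KC.
exists (expR l0), (4 * K2)^-1; split.
- exact: expR_gt0.
- by rewrite invr_gt0 mulr_gt0.
move=> x hx A delta hA hcard hdelta.
have x0 : 0 < x by apply: lt_le_trans hx; apply: expR_gt0.
have := ln_ge_of_expR_le hx; set l := ln x in hcard hdelta * => hl0.
have xl : x = expR l by rewrite lnK.
have pla : la <= `|la| := ler_norm la.
have plb : lb <= `|lb| := ler_norm lb.
have na : 0 <= `|la| := normr_ge0 la.
have eb : 0 < expR `|lb| := expR_gt0 _.
have e1 : 2 <= expR 1 :> R by have := expR_ge1Dx (1 : R); lra.
have KC0 : 0 <= KC.
  have h : 0 <= C by apply: le_trans ler01 C0.
  have h' : (0 : R) <= 288 := ler0n R 288.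
  by rewrite defKC; apply: mulr_ge0; [apply: mulr_ge0 h' (exprn_ge0 _ h)|exact: addr_ge0 (ler0n R 6) h].
rewrite /l0 in hl0; clear l0 hx.
have {hla} hE : K * l ^+ (2 * e + 14) <= expR (l / 48) by apply: hla; lra.
have hKC : KC <= l by lra.
have l2 : 2 <= l by lra.
have lnl1 : 1 <= ln l by apply: ln_ge_of_expR_le; lra.
have hK2 : K2 * ln l <= l.
  have h1 : lb <= ln l by apply: ln_ge_of_expR_le; apply: le_trans (_ : expR `|lb| <= _); [rewrite ler_expR|lra].
  by have := hlb _ h1; rewrite expr1 divr1 lnK // posrE; lra.
clear hl0 KC0 eb na pla plb hlb.
have l1 : 1 <= l by lra.
have lp : 0 < l by lra.
set E := expR (l / 48) in hE.
have Ep : 0 < E by apply: expR_gt0.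
have lm1 : 1 <= l ^+ (2 * e + 14) by rewrite exprn_ege1.
have lmono i : (i <= 2 * e + 14)%N -> l ^+ i <= l ^+ (2 * e + 14) by move=> h; rewrite ler_weXn2l.
set lm := l ^+ (2 * e + 14) in hE lm1 lmono.
have hE1 : K1 * lm <= E.
  by apply: le_trans hE; rewrite ler_wpM2r ?(le_trans ler01 lm1) // defK; lra.
have hE2 : 2 ^+ em * lm <= E.
  by apply: le_trans hE; rewrite ler_wpM2r ?(le_trans ler01 lm1) // defK; lra.
have hE3 : 4 * lm <= E.
  by apply: le_trans hE; rewrite ler_wpM2r ?(le_trans ler01 lm1) // defK; lra.
have E4 : 4 <= E by lra.
pose y := Num.trunc E.
have [yE Ey] : (y%:R : R) <= E /\ E < y.+1%:R.
  by have /andP[] := truncn_itv (ltW Ep).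
pose w := (Num.trunc l).+1.
have [lw wl] : l <= w%:R /\ (w%:R : R) <= 2 * l.
  have /andP[h1 h2] := truncn_itv (ltW lp); split; first exact: ltW.
  by rewrite /w -natr1; lra.
pose z := (w ^ em)%N.
pose N := (Num.trunc x).+1.
have [xN Nx] : x < N%:R /\ (N%:R : R) <= 2 * x.
  have /andP[h1 h2] := truncn_itv (ltW x0); split => //.
  have : 1 <= x by rewrite xl; apply: le_trans (expR_ge1Dx _); lra.
  by rewrite /N -natr1; lra.
(* Since [x <= 4 ^ w], one has [2 * N <= 4 * x <= 2 ^ (2 * w + 2)]. *)
pose k := (2 * w + 2)%N.
have Nk : (2 * N <= 2 ^ k)%N.
  rewrite -(ler_nat R) natrM natrX /k exprD exprM.
  have -> : (2 : R) ^+ 2 = 2 * 2 by rewrite expr2.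
  have h : x <= (2 * 2) ^+ w by have := expR_le_4X lw; rewrite -xl -natrM.
  apply: (@le_trans _ _ (x * (2 * 2))); last by rewrite ler_wpM2r // mulr_ge0.
  by rewrite mulrA [leRHS]mulrC ler_wpM2l // mulrC.
have kl : (k%:R : R) <= 6 * l by rewrite /k natrD natrM; lra.
have zl : l ^+ em <= z%:R :> R.
  by rewrite natrX lerXn2r // nnegrE // ltW.
have zy : (z <= y)%N.
  rewrite /y truncn_ge_nat ?(ltW Ep) // natrX; apply: le_trans hE2.
  apply: (@le_trans _ _ ((2 * l) ^+ em)).
    by rewrite lerXn2r // nnegrE // mulr_ge0 // ltW.
  by rewrite exprMn ler_wpM2l //; exact: lmono.
have w2 : (1 < w)%N.
  by rewrite -(ltr_nat R); apply: lt_le_trans lw; lra.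
have z1 : (1 < z)%N.
  by rewrite /z -(exp1n em) ltn_exp2r.
have y1 : (1 < y)%N by apply: leq_trans z1 zy.
pose I := primes_in z y.
pose p (i : I) : nat := val (val i).
pose D := [set Q : {set I} | (\prod_(i in Q) p i <= y)%N].
pose M : R := \prod_(i : I) (1 + ((p i)%:R - 1)^-1).
pose L : R := \sum_(Q in D) \prod_(i in Q) ((p i)%:R - 1)^-1.
have MC : M <= C * l.
  apply: le_trans (prod_primes_in_le R z y1) _; rewrite -defC1.
  have h : ln (y%:R : R) <= l.
    have yp : (0 : R) < y%:R by rewrite ltr0n ltnW.
    apply: (@le_trans _ _ (ln E)); first by rewrite ler_ln // posrE.
    by rewrite expRK ler_pdivrMr // ler_peMr // ?(ltW lp) // ler1n.
  apply: (@le_trans _ _ (C1 * (2 * l))); last by rewrite defC mulrCA mulrA.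
  by rewrite ler_wpM2l ?(le_trans ler01 C11) // [2 * _]mulr_natl mulr2n lerD.
have M0 : 0 <= M.
  apply: prodr_ge0 => i _; rewrite addr_ge0 // invr_ge0 subr_ge0 ler1n.
  by case: (primes_inP i) => /prime_gt0.
have lL : l <= K2 * ln l * L.
  have h1 : l / 48 <= ln (y.+1%:R : R).
    by apply: ln_ge_of_expR_le; exact: ltW.
  have h2 := selberg_sum_ge R zy.
  have h3 := mertens_prod_le R z1.
  have L0 : 0 <= L.
    apply: sumr_ge0 => Q _; apply: prodr_ge0 => i _; rewrite invr_ge0 subr_ge0 ler1n.
    by case: (primes_inP i) => /prime_gt0.
  have eL : \sum_(Q : {set I} | (\prod_(i in Q) p i <= y)%N) \prod_(i in Q) ((p i)%:R - 1)^-1 = L.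
    by apply: eq_bigl => Q; rewrite inE.
  rewrite eL in h2.
  have h4 : 1 + ln (z%:R : R) <= (2 * em%:R + 1) * ln l.
    have wp : (0 : R) < w%:R by rewrite ltr0n.
    rewrite natrX lnXn //.
    have : ln (w%:R : R) <= 2 * ln l.
      apply: (@le_trans _ _ (ln (l * l))).
        rewrite ler_ln ?posrE ?mulr_gt0 //.
        by apply: le_trans wl _; rewrite ler_pM2r.
      by rewrite lnM ?posrE // [2 * _]mulr_natl mulr2n.
    move=> h; rewrite -[ln _ *+ _]mulr_natl addrC.
    have -> : (2 * em%:R + 1) * ln l = em%:R * (2 * ln l) + ln l by ring.
    by rewrite lerD // ler_wpM2l.
  have h5 : ln (y.+1%:R : R) <= C1 * ((2 * em%:R + 1) * ln l) * L.
    apply: le_trans h2 _; rewrite ler_wpM2r //; apply: le_trans h3 _.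
    by rewrite -defC1 ler_wpM2l // (le_trans ler01).
  have : l / 48 <= C1 * ((2 * em%:R + 1) * ln l) * L by apply: le_trans h1 h5.
  rewrite ler_pdivrMr // => h; apply: le_trans h _.
  by rewrite defK2 le_eqVlt; apply/orP; left; apply/eqP; ring.
have L1 : 1 <= L.
  have Kl : 0 < K2 * ln l by rewrite mulr_gt0 // (lt_le_trans ltr01).
  by rewrite -(ler_pM2l Kl) mulr1; apply: le_trans hK2 lL.
have pp i : prime (p i) by case: (primes_inP i).
have pinj : injective p by move=> i j h; do 2 apply: val_inj.
have zp i : (z < p i)%N by case: (primes_inP i).
have py i : (p i <= y)%N by case: (primes_inP i).
have hD Q : Q \in D -> (\prod_(i in Q) p i <= y)%N by rewrite inE.
have pA q : q \in A -> prime q by case/hA.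
have AN q : q \in A -> (q < N)%N.
  by case/hA => _ /andP[_ h]; rewrite -(ltr_nat R); apply: le_lt_trans h xN.
have := sumset_large_or_few (erefl M) (erefl L) L1 pp pinj zp (ltnW z1) py hD pA AN Nk.
set s : R := #|` sumset A A|%:R; set a : R := #|` A|%:R in hcard *.
set a' : R := #|` [fset q in A | (y < q)%N]|%:R => /= hcase.
have ha : x <= a * l ^+ e.+1.
  have h : (l ^+ e)^-1 <= delta.
    apply: le_trans hdelta; apply: powRN_ge => //.
    by rewrite /e ltW // truncnS_gt.
  rewrite hcard (_ : delta * x / l * l ^+ e.+1 = delta * l ^+ e * x); last first.
    by rewrite exprS; field; rewrite gt_eqF.
  rewrite ler_peMl ?(ltW x0) //.
  by rewrite -ler_pdivrMr ?exprn_gt0 // mul1r.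
have xE : x = E ^+ 48 by rewrite xl /E -expRM_natl; congr expR; field.
have ha' : a <= 2 * a'.
  have h1 : a <= a' + y.+1%:R by rewrite -natrD ler_nat cardfs_le_above.
  have le0 : 0 < l ^+ e.+1 by rewrite exprn_gt0.
  (* At most [y.+1 <= E + 1] elements of [A] are lost by restricting to primes above [y], so this
     makes the loss at most half of [A]. *)
  have h2 : 4 * E <= a.
    rewrite -(ler_pM2r le0); apply: le_trans ha.
    apply: (@le_trans _ _ (E * E)).
      rewrite mulrAC ler_pM2r //; apply: le_trans hE3; rewrite ler_pM2l //.
      exact: lmono.
    by rewrite xE -expr2 ler_weXn2l // (le_trans _ E4) // ler1n.
  by move: h1; rewrite -natr1; lra.
case: hcase => [hs|hfew]; last first.
  rewrite defK1 in hE1; rewrite defKC in hKC.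
  exfalso; apply: (few_contradiction (e := e) l1 C0 xE E4 hE1 hKC ha ha' _ _ _ _ zl hfew).
  - by rewrite M0.
  - by rewrite ler0n.
  - by rewrite ler0n.
  - by rewrite ler0n.
have lnl0 : 0 < ln l by apply: lt_le_trans lnl1.
rewrite ler_pdivrMr // -!mulrA ler_pdivrMl ?mulr_gt0 //.
have -> : delta * x = a * l by rewrite hcard divfK // gt_eqF.
have a0 : 0 <= a by apply: ler0n.
(* The constant [4 * K2] combines [a <= 2 * a'], [l <= K2 * ln l * L] and [a' * L <= 2 * s]. *)
apply: (@le_trans _ _ (2 * a' * (K2 * ln l * L))).
  by apply: ler_pM => //; exact: ltW.
have -> : 2 * a' * (K2 * ln l * L) = (a' * L) * (2 * (K2 * ln l)) by ring.
have -> : 4 * K2 * (s * ln l) = (2 * s) * (2 * (K2 * ln l)) by ring.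
by rewrite ler_wpM2r // !mulr_ge0 // ltW.
Qed.
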